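(* Let $k$ be an algebraically closed field of characteristic $p\geq 3$, let $d\ge 1$, let $\lambda=(\lambda_1,\lambda_2,\ldots)\vdash d$ be a partition of $d$, and let $r$ be a positive integer with $p^r>d$. Then $$\mathrm{H}^1(\Sigma_d, S^\lambda)\cong \mathrm{H}^1(\Sigma_{d+p^r}, S^{\lambda+p^r}),$$ where $\lambda+p^r$ denotes the partition $(\lambda_1+p^r,\lambda_2,\lambda_3,\ldots)$ of $d+p^r$.
   Context: $\Sigma_m$ is the symmetric group on $m$ letters. For a partition $\mu\vdash m$, $S^\mu$ denotes the Specht module for $k\Sigma_m$ in James' convention (the submodule of the Young permutation module $M^\mu$ spanned by the polytabloids, so that $S^{(m)}$ is the trivial module $k$); it is to be distinguished from its linear dual $S_\mu$. $\mathrm{H}^i(\Sigma_m,M)=\mathrm{Ext}^i_{k\Sigma_m}(k,M)$. *)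

(* Defs.v *)
From HB Require Import structures.
From mathcomp Require Import all_boot all_order all_fingroup all_algebra.
From mathcomp Require Import mxrepresentation vector.
From mathcomp Require Import generic_quotient ring_quotient.

Set Implicit Arguments.
Unset Strict Implicit.
Unset Printing Implicit Defensive.

Import GroupScope GRing.Theory.
Local Open Scope ring_scope.

Section QuotientSpace.

Local Open Scope quotient_scope.
Variables (F : fieldType) (V : vectType F) (W : {vspace V}).

Definition quotv := Quotient.quot (pred_of_vspace W : zmodClosed V).

HB.instance Definition _ := GRing.Zmodule.on quotv.
HB.instance Definition _ := EqQuotient.on quotv.

Lemma eq_quotv (u v : V) : (\pi_quotv u == \pi_quotv v) = (u - v \in W).
Proof. by rewrite -Quotient.idealrBE. Qed.

Lemma pi_quotvD (u v : V) : \pi_quotv (u + v) = \pi_quotv u + \pi_quotv v.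
Proof. exact: Quotient.pi_add. Qed.

Definition quotv_scale (a : F) (q : quotv) : quotv := \pi_quotv (a *: repr q).

Lemma pi_quotvZ a (u : V) : \pi_quotv (a *: u) = quotv_scale a (\pi u).
Proof.
apply/eqP; rewrite eq_quotv -scalerBr memvZ // -eq_quotv.
by rewrite reprK.
Qed.

Fact quotv_scaleA a b q :
  quotv_scale a (quotv_scale b q) = quotv_scale (a * b) q.
Proof. by elim/quotW: q => u; rewrite -(pi_quotvZ b) -!pi_quotvZ scalerA. Qed.

Fact quotv_scale1 : left_id 1 quotv_scale.
Proof. by elim/quotW=> u; rewrite -pi_quotvZ scale1r. Qed.

Fact quotv_scaleDr : right_distributive quotv_scale +%R.
Proof.
move=> a; elim/quotW=> u; elim/quotW=> v.
by rewrite -pi_quotvD -!pi_quotvZ -pi_quotvD scalerDr.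
Qed.

Fact quotv_scaleDl q : {morph quotv_scale^~ q : a b / a + b}.
Proof.
by elim/quotW: q => u a b; rewrite -!pi_quotvZ -pi_quotvD scalerDl.
Qed.

HB.instance Definition _ := GRing.Zmodule_isLmodule.Build F quotv
  quotv_scaleA quotv_scale1 quotv_scaleDr quotv_scaleDl.

End QuotientSpace.

(* Group cohomology H^i(G, V) = Ext^i_{FG}(F, V), computed by applying        *)
(* Hom_{FG}(-, V) to the standard resolution P_i = F[G^(i+1)] of the trivial  *)
(* module.  As in mxrepresentation, modules are right modules, acting on row  *)
(* vectors.  P_i is the permutation module with basis G^(i+1) and diagonal    *)
(* action (g_0, .., g_i) g = (g_0 g, .., g_i g), so an FG-linear map P_i -> V *)
(* is a function f : G^(i+1) -> V such that f (s g) = f s *m rG g.            *)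
Section GroupCohomology.

Variables (F : fieldType) (gT : finGroupType) (n : nat).
Variable rG : mx_representation F [set: gT] n.

Definition bar_basis (i : nat) : Type := {ffun 'I_i.+1 -> gT}.
HB.instance Definition _ i := Finite.on (bar_basis i).

Definition bar_act i (s : bar_basis i) (g : gT) : bar_basis i :=
  [ffun j => (s j * g)%g].

Definition bar_face i (j : 'I_i.+2) (s : bar_basis i.+1) : bar_basis i :=
  [ffun l => s (lift j l)].

Definition bar_fun (i : nat) : Type := {ffun bar_basis i -> 'rV[F]_n}.
HB.instance Definition _ i := Vector.on (bar_fun i).

Definition equiv_defect i (g : gT) (f : bar_fun i) : bar_fun i :=
  [ffun s => f (bar_act s g) - f s *m rG g].

Fact equiv_defect_linear i g : linear (@equiv_defect i g).
Proof.
move=> a u v; apply/ffunP=> s; rewrite !ffunE mulmxDl -scalemxAl.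
by rewrite scalerBr opprD addrACA.
Qed.
HB.instance Definition _ i g := GRing.isLinear.Build F (bar_fun i) (bar_fun i)
  _ (@equiv_defect i g) (@equiv_defect_linear i g).

Definition cochains i : {vspace bar_fun i} :=
  (\bigcap_(g : gT) lker (linfun (@equiv_defect i g)))%VS.

Lemma cochainsP i (f : bar_fun i) :
  reflect (forall (g : gT) (s : bar_basis i), f (bar_act s g) = f s *m rG g)
          (f \in cochains i).
Proof.
apply: (iffP idP) => [|fG].
  rewrite memvE => /subv_bigcapP fG g s; have := fG g isT.
  rewrite -memvE memv_ker lfunE => /eqP/ffunP/(_ s).
  by rewrite !ffunE => /eqP; rewrite subr_eq0 => /eqP.
rewrite memvE; apply/subv_bigcapP => g _; rewrite -memvE memv_ker lfunE.
by apply/eqP/ffunP=> s; rewrite !ffunE fG subrr.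
Qed.

Definition cobound i (f : bar_fun i) : bar_fun i.+1 :=
  [ffun s => \sum_(j < i.+2) (-1) ^+ j *: f (bar_face j s)].

Fact cobound_linear i : linear (@cobound i).
Proof.
move=> a u v; apply/ffunP=> s; rewrite !ffunE scaler_sumr -big_split /=.
apply: eq_bigr => j _.
by rewrite !ffunE scalerDr !scalerA [_ * a]mulrC.
Qed.
HB.instance Definition _ i := GRing.isLinear.Build F (bar_fun i) (bar_fun i.+1)
  _ (@cobound i) (@cobound_linear i).

Definition cocycles i : {vspace bar_fun i} :=
  (cochains i :&: lker (linfun (@cobound i)))%VS.

Definition coboundaries i : {vspace bar_fun i} :=
  match i with
  | 0 => 0%VS
  | j.+1 => (linfun (@cobound j) @: cochains j)%VS
  end.

Lemma cocyclesP i (f : bar_fun i) :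
  reflect ((forall (g : gT) (s : bar_basis i), f (bar_act s g) = f s *m rG g)
           /\ cobound f = 0)
          (f \in cocycles i).
Proof.
rewrite memv_cap memv_ker lfunE.
by apply: (iffP andP) => -[/cochainsP fG /eqP df].
Qed.

Definition cohomology i : Type :=
  quotv (linfun (@vsval _ _ (cocycles i)) @^-1: coboundaries i)%VS.
HB.instance Definition _ i := GRing.Lmodule.on (cohomology i).

End GroupCohomology.

Definition is_partition (m : nat) (mu : seq nat) : bool :=
  [&& sorted geq mu, 0%N \notin mu & sumn mu == m].

Definition add_first_part (mu : seq nat) (a : nat) : seq nat :=
  (head 0%N mu + a)%N :: behead mu.

Section Specht.

Variables (F : fieldType) (m : nat) (mu : seq nat).

Definition diagram : Type := {i : 'I_(size mu) & 'I_(nth 0%N mu i)}.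
HB.instance Definition _ := Finite.on diagram.

Definition cell_row (c : diagram) : 'I_(size mu) := tag c.
Definition cell_col (c : diagram) : nat := tagged c.

(* A tableau is recorded by the bijection sending each entry to the cell that *)
(* contains it.                                                               *)
Definition is_tableau (t : {ffun 'I_m -> diagram}) : bool :=
  injectiveb t && [forall c, c \in codom t].

Definition tableau : Type := {t : {ffun 'I_m -> diagram} | is_tableau t}.
HB.instance Definition _ := Finite.on tableau.

(* A tabloid (row-equivalence class of tableaux) is recorded by the function  *)
(* sending each entry to the index of its row.                                *)
Definition is_tabloid (f : {ffun 'I_m -> 'I_(size mu)}) : bool :=
  [forall i, #|[set x | f x == i]| == nth 0%N mu i].

Definition tabloid : Type := {f : {ffun 'I_m -> 'I_(size mu)} | is_tabloid f}.
HB.instance Definition _ := Finite.on tabloid.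

Fact tabloid_of_subproof (t : tableau) :
  is_tabloid [ffun x => cell_row (val t x)].
Proof.
case: t => t /= /andP[/injectiveP t_inj /forallP t_surj]; apply/forallP=> i.
have tag_inj : injective (fun j : 'I_(nth 0%N mu i) =>
    Tagged (fun i : 'I_(size mu) => 'I_(nth 0%N mu i)) j : diagram).
  by move=> j k; apply: eq_from_Tagged.
have -> : nth 0%N mu i = #|[set: 'I_(nth 0%N mu i)]| by rewrite cardsT card_ord.
rewrite -(card_imset _ tag_inj) -(card_imset _ t_inj); apply/eqP/eq_card=> c.
apply/imsetP/imsetP=> [[x] | [j _ ->]].
  rewrite inE ffunE => /eqP <- ->.
  by exists (tagged (t x)); rewrite ?inE //; case: (t x).
have /codomP[x tx] := t_surj (Tagged (fun i : 'I_(size mu) => 'I_(nth 0%N mu i)) j).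
by exists x; rewrite // inE ffunE -tx.
Qed.

Definition tabloid_of (t : tableau) : tabloid :=
  Sub [ffun x => cell_row (val t x)] (tabloid_of_subproof t).

(* Permutations act on the right by replacing each entry x by s x: the row of *)
(* x in the new tabloid is the row of s^-1 x in the old one.                  *)
Fact tabloid_act_subproof (T : tabloid) (s : 'S_m) :
  is_tabloid [ffun x => val T (s^-1 x)%g].
Proof.
case: T => T /= /forallP tabT; apply/forallP=> i.
rewrite -(eqP (tabT i)) -[X in _ == X](card_imset _ (@perm_inj _ s)).
apply/eqP/eq_card=> x.
apply/idP/imsetP=> [|[y]]; last by rewrite !inE ffunE => Ty ->; rewrite permK.
by rewrite inE ffunE => Tx; exists (s^-1 x)%g; rewrite ?inE ?permKV.
Qed.

Definition tabloid_act (T : tabloid) (s : 'S_m) : tabloid :=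
  Sub [ffun x => val T (s^-1 x)%g] (tabloid_act_subproof T s).

Lemma tabloid_act1 T : tabloid_act T 1%g = T.
Proof. by apply/val_inj/ffunP=> x; rewrite ffunE invg1 perm1. Qed.

Lemma tabloid_actM T s u :
  tabloid_act T (s * u)%g = tabloid_act (tabloid_act T s) u.
Proof. by apply/val_inj/ffunP=> x; rewrite !ffunE invMg permM. Qed.

(* The vector {T} of M^mu, whose basis is indexed by the tabloids.            *)
Definition tabloid_vec (T : tabloid) : 'rV[F]_#|{: tabloid}| :=
  delta_mx 0 (enum_rank T).

Definition young_mx (s : 'S_m) : 'M[F]_#|{: tabloid}| :=
  \matrix_(i < #|{: tabloid}|) tabloid_vec (tabloid_act (enum_val i) s).

Lemma tabloid_vecM T s :
  tabloid_vec T *m young_mx s = tabloid_vec (tabloid_act T s).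
Proof. by rewrite -rowE rowK enum_rankK. Qed.

Fact young_mx_repr : mx_repr [set: 'S_m] young_mx.
Proof.
split=> [|s u _ _]; apply/row_matrixP=> i.
  by rewrite rowK tabloid_act1 rowE mulmx1 /tabloid_vec enum_valK.
by rewrite row_mul !rowK tabloid_vecM tabloid_actM.
Qed.

Definition young_repr : mx_representation F [set: 'S_m] #|{: tabloid}| :=
  MxRepresentation young_mx_repr.

Definition col_stab (t : tableau) : {set 'S_m} :=
  [set s : 'S_m | [forall x, cell_col (val t (s x)) == cell_col (val t x)]].

Definition polytabloid (t : tableau) : 'rV[F]_#|{: tabloid}| :=
  \sum_(s in col_stab t) (-1) ^+ s *: tabloid_vec (tabloid_act (tabloid_of t) s).

Definition specht_mx : 'M[F]_#|{: tabloid}| :=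
  (\sum_(t : tableau) <<polytabloid t>>)%MS.

Fact tableau_act_subproof (t : tableau) (s : 'S_m) :
  is_tableau [ffun x => val t (s^-1 x)%g].
Proof.
case: t => t /= /andP[/injectiveP t_inj /forallP t_surj]; apply/andP; split.
  by apply/injectiveP=> x y; rewrite !ffunE => /t_inj/perm_inj.
apply/forallP=> c; have /codomP[x ->] := t_surj c.
by apply/codomP; exists (s x); rewrite ffunE permK.
Qed.

Definition tableau_act (t : tableau) (s : 'S_m) : tableau :=
  Sub [ffun x => val t (s^-1 x)%g] (tableau_act_subproof t s).

Lemma polytabloidM t s :
  polytabloid t *m young_mx s = polytabloid (tableau_act t s).
Proof.
have tT : tabloid_of (tableau_act t s) = tabloid_act (tabloid_of t) s.
  by apply/val_inj/ffunP=> x; rewrite !ffunE.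
rewrite /polytabloid mulmx_suml tT [RHS](reindex_inj (conjg_inj s)) /=.
apply: eq_big => [u | u _].
  rewrite !inE; apply/forallP/forallP=> tu x; rewrite /= ?ffunE.
    by rewrite conjgE !permM permK (eqP (tu _)).
  by have := tu (s x); rewrite /= !ffunE conjgE !permM !permK.
rewrite -scalemxAl tabloid_vecM -!tabloid_actM odd_permJ.
by rewrite conjgE mulgA mulgV mul1g.
Qed.

Fact specht_mxmodule : mxmodule young_repr specht_mx.
Proof.
apply/mxmoduleP=> s _; rewrite sumsmxMr; apply/sumsmx_subP=> t _.
rewrite (eqmxMr _ (genmxE _)) /= polytabloidM.
by apply: (sumsmx_sup (tableau_act t s)); rewrite // genmxE.
Qed.

Definition specht : mx_representation F [set: 'S_m] (\rank specht_mx) :=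
  submod_repr specht_mxmodule.

End Specht.

(* Main.v *)
(* Vectors of M^la are functions on words of content la, that is, elements of *)
(* the la-weight space of the d-th tensor power of the natural module E, and  *)
(* the divided powers e_i^(m) of the simple root vectors act on them.  By     *)
(* James' kernel intersection theorem S^la is the common kernel of the        *)
(* e_i^(m), m > 0.  As p > 2, H^1(S_d, M^la) = 0, so H^1(S_d, S^la) is the    *)
(* space of all u in M^la with every e_i^(m) u invariant under S_d, modulo    *)
(* S^la and the invariants.  Such a u amounts to a 1-cocycle (e_i^(m) u) for  *)
(* the upper unipotent hyperalgebra with values in the invariant tensors      *)
(* D^d E, of weight la; conversely every such cocycle comes from some u,      *)
(* because Ext^1 over the Borel subgroup from the dominant weight la to the   *)
(* tensor power of E vanishes.  Finally, multiplication by e_0^(p^r) commutes *)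
(* with the e_i^(m), and carries the cocycles with values in D^d E of weight  *)
(* la bijectively to those of weight la + p^r in degree d + p^r: the binomial *)
(* coefficients involved are 1 modulo p since d < p^r.                        *)
From HB Require Import structures.
Require Import Defs.
From mathcomp Require Import all_boot all_order all_fingroup all_algebra.
From mathcomp Require Import mxrepresentation vector generic_quotient.
From mathcomp Require Import zify ring.
From mathcomp Require Import boolp functions.

Set Implicit Arguments.
Unset Strict Implicit.
Unset Printing Implicit Defensive.

Import GRing.Theory.
Local Open Scope ring_scope.

(** * Divided powers acting on functions of words *)

(** A 1-cocycle with values in S^la becomes a coboundary in M^la ([cocycle_coboundary]), so it has
    the form g |-> u g - u with u in M^la and every u g - u in S^la. Since S^la is the common kernel
    of the [divpow i m], m > 0 ([specht_kernel]), and these commute with S_d, the condition on u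
    says that every [divpow i m u] is symmetric ([sub_specht_symw]). The class of u is zero exactly
    when these functions are those of a multiple of [total], the invariant vector of M^la
    ([coboundary_total]). Thus H^1 only sees the family of all [divpow i m u].

    Families in degrees d and d + p^r are compared by [mulz], which commutes with [divpow] and is
    injective on symmetric functions of degree d, because C(p^r + e, p^r) = 1 in k for e < p^r
    ([bin_pfactorD]). Forwards, u goes to its image under [mulz]. Backwards, restriction to words
    that begin with p^r zeros yields a family satisfying the relations [cocycle], and the main point
    is that such a family comes from some u ([cocycle_lift]).

    Both [cocycle_lift] and James' theorem [kernel_tab_span] are proved by peeling off the first
    letter j of words, largest j first. Taking one j away from la leaves either a smaller partition,
    where induction applies, or a weight mu with mu (j+1) = mu j + 1. In the second case the
    operators e_j^(m) alone settle the matter, by inclusion-exclusion ([divpow_inj],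
    [divpow_lift]). *)

Section DividedPowers.

Variable k : comNzRingType.
Notation wfun := (seq nat -> k^o).
Implicit Types (f g : wfun) (x y z : seq nat).

Definition slice a f : wfun := fun z => f (a :: z).

Fact slice_linear a : linear (slice a). Proof. by []. Qed.
HB.instance Definition _ a := GRing.isLinear.Build k wfun wfun _ (slice a)
  (slice_linear a).

Lemma wfunP f g : f [::] = g [::] -> (forall a, slice a f = slice a g) -> f = g.
Proof. by move=> fg0 fg; apply/funext => -[//|a x];
  have /(congr1 (@^~ x)) := fg a. Qed.

(* All ways of turning exactly [n] letters [e] of [x] into [b], every other   *)
(* letter [c] becoming [r c].                                                 *)
Fixpoint recolorings (r : nat -> nat) (e b n : nat) x : seq (seq nat) :=
  if x is c :: x' then
    map (cons (r c)) (recolorings r e b n x') ++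
    (if (c == e) && (0 < n)%N then map (cons b) (recolorings r e b n.-1 x')
     else [::])
  else if n == 0%N then [:: [::]] else [::].

Definition recolor r e b n f : wfun :=
  fun x => \sum_(y <- recolorings r e b n x) f y.

Fact recolor_linear r e b n : linear (recolor r e b n).
Proof.
move=> a f g; apply/funext => x.
by rewrite [LHS]big_split /= -scaler_sumr.
Qed.
HB.instance Definition _ r e b n :=
  GRing.isLinear.Build k wfun wfun _ (recolor r e b n) (recolor_linear r e b n).

Lemma recolor_nil r e b n f : recolor r e b n f [::] = f [::] *+ (n == 0%N).
Proof.
by rewrite /recolor /=; case: (n == 0%N); rewrite ?big_nil ?big_seq1.
Qed.

Lemma slice_recolor r e b n f c :
  slice c (recolor r e b n f) = recolor r e b n (slice (r c) f) +
    recolor r e b n.-1 (slice b f) *+ ((c == e) && (0 < n)%N).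
Proof.
apply/funext=> x; rewrite /slice /recolor /= big_cat big_map /= mulrb.
by case: ifP => _; rewrite ?big_nil // big_map.
Qed.

Lemma recolorings_small r e b n x :
  (count_mem e x < n)%N -> recolorings r e b n x = [::].
Proof.
elim: x n => [|c x IH] n /=; first by case: n.
case: eqP => _ /= lt_n; last by rewrite IH.
by case: n lt_n => // n; rewrite add1n ltnS => lt_n; rewrite !IH // ltnS ltnW.
Qed.

Lemma recolorings_all r e b x :
  recolorings r e b (count_mem e x) x =
    [:: [seq if c == e then b else r c | c <- x]].
Proof.
elim: x => [|c x IH] //=.
case: eqP => _ /=; last by rewrite add0n IH.
by rewrite add1n recolorings_small //= IH.
Qed.

Lemma recolor_small r e b n f x : (count_mem e x < n)%N -> recolor r e b n f x = 0.
Proof. by move=> ?; rewrite /recolor recolorings_small ?big_nil. Qed.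

Lemma recolor_all r e b f x :
  recolor r e b (count_mem e x) f x = f [seq if c == e then b else r c | c <- x].
Proof. by rewrite /recolor recolorings_all big_seq1. Qed.

Lemma eq_recolor r e b n f g x :
  {in recolorings r e b n x, f =1 g} -> recolor r e b n f x = recolor r e b n g x.
Proof. exact: eq_big_seq. Qed.

Lemma recolor_neq0 r e b n f x :
  recolor r e b n f x != 0 -> exists2 y, y \in recolorings r e b n x & f y != 0.
Proof.
rewrite /recolor big_seq => nz; apply/hasP; apply: contra_neqT nz => /hasPn f0.
by rewrite big1 // => y /f0; rewrite negbK => /eqP.
Qed.

Lemma recolorings_count r e b n x y :
  y \in recolorings r e b n x ->
  forall l : nat, (count_mem l y + n * (l == r e))%N =
    (count_mem l (map r x) + n * (l == b))%N.
Proof.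
elim: x n y => [|c x IH] n y /=.
  by case: eqP => [-> /[!inE] /eqP -> //|_ //].
rewrite mem_cat => /orP[/mapP[z zx ->] l|]; first by rewrite /= -addnA IH // addnA.
case: ifP => // /andP[/eqP -> n_gt0] /mapP[z zx ->] l /=.
by have := IH _ _ zx l; case: n n_gt0 {zx} => // n _; rewrite /= !(eq_sym l); lia.
Qed.

(* The divided power e_i^(m), where e_i maps the basis vector e_(i+1) of E to *)
(* e_i, acting on the coordinates of tensors.                                 *)
Definition divpow i m f := recolor id i i.+1 m f.
HB.instance Definition _ i m := GRing.isLinear.Build k wfun wfun _ (divpow i m)
  (recolor_linear id i i.+1 m).

Lemma divpow_count i m x y : y \in recolorings id i i.+1 m x ->
  forall l : nat, (count_mem l y + m * (l == i))%N =
    (count_mem l x + m * (l == i.+1))%N.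
Proof. by move=> /recolorings_count yx l; rewrite yx map_id. Qed.

Lemma divpow_nil i m f : divpow i m f [::] = f [::] *+ (m == 0%N).
Proof. exact: recolor_nil. Qed.

Lemma slice_divpow i m f a :
  slice a (divpow i m f) = divpow i m (slice a f) +
    divpow i m.-1 (slice i.+1 f) *+ ((a == i) && (0 < m)%N).
Proof. exact: slice_recolor. Qed.

Lemma divpow0 i f : divpow i 0 f = f.
Proof.
apply/funext => x; elim: x f => [|a x IH] f; first by rewrite divpow_nil.
by rewrite -[LHS]/(slice a (divpow i 0 f) x) slice_divpow andbF addr0 IH.
Qed.

Lemma divpow_comp i a b f :
  divpow i a (divpow i b f) = divpow i (a + b) f *+ 'C(a + b, a).
Proof.
apply/funext => x; elim: x a b f => [|c x IH] a b f.
  rewrite natmulfctE !divpow_nil.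
  by case: a b => [|a] [|b]; rewrite ?mul0rn ?bin0.
transitivity (slice c (divpow i a (divpow i b f)) x) => //.
transitivity (slice c (divpow i (a + b) f *+ 'C(a + b, a)) x); last by [].
rewrite !raddfMn !slice_divpow !raddfD !raddfMn /= slice_divpow.
have -> : (i.+1 == i) = false by lia.
rewrite andFb mulr0n addr0 !addrfctE !natmulfctE !IH !natmulfctE.
case: eqP => [_|_] /=; last by rewrite !mulr0n !addr0.
case: a b => [|a] [|b] /=;
  rewrite ?add0n ?addn0 ?bin0 ?binn ?mulr1n ?mulr0n ?addr0 //.
by rewrite !addSn !addnS mulrnDl -addrA -mulrnDr -binS.
Qed.

(** Lowering the first index and lowering the second give opposite sums (see [alternating_shiftr]),
    so the two contributions cancel in [slice_serre] and [hop_kop]. *)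
Lemma alternating_shiftl (V : lmodType k) (A : nat -> nat -> V) a :
  \sum_(b < a.+1) (-1) ^+ b *: (A (a - b).-1 b *+ (0 < a - b)%N) =
  (\sum_(b < a.-1.+1) (-1) ^+ b *: A (a.-1 - b)%N b) *+ (0 < a)%N.
Proof.
case: a => [|a]; first by rewrite big_ord1 subnn mulr0n scaler0.
rewrite big_ord_recr /= subnn mulr0n scaler0 addr0 mulr1n.
by apply: eq_bigr => b _; rewrite subSn -1?ltnS.
Qed.

Lemma alternating_shiftr (V : lmodType k) (A : nat -> nat -> V) a :
  \sum_(b < a.+1) (-1) ^+ b *: (A (a - b)%N b.-1 *+ (0 < b)%N) =
  - ((\sum_(b < a.-1.+1) (-1) ^+ b *: A (a.-1 - b)%N b) *+ (0 < a)%N).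
Proof.
rewrite big_ord_recl /= mulr0n scaler0 add0r.
case: a => [|a]; first by rewrite big_ord0 mulr0n oppr0.
rewrite mulr1n -sumrN; apply: eq_bigr => b _.
by rewrite /= /bump /= add1n subSS mulr1n exprS mulN1r scaleNr.
Qed.

(* The coefficient of t^a in exp(t e_j) e_i^(m) exp(-t e_j). *)
Definition serre_sum i j m a f : wfun :=
  \sum_(b < a.+1) (-1) ^+ b *: divpow j (a - b) (divpow i m (divpow j b f)).

Let serre_shiftl i j m a f := alternating_shiftl
  (fun u v => divpow j u (divpow i m (divpow j v f))) a.

Let serre_shiftr i j m a f := alternating_shiftr
  (fun u v => divpow j u (divpow i m (divpow j v f))) a.

(* Conjugating e_i by exp(t e_j) produces the commutator [e_j, e_i] in the    *)
(* first letter, which survives only for adjacent i and j.                    *)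
Lemma slice_serre (i j m a : nat) f c : i != j ->
  slice c (serre_sum i j m a f) = serre_sum i j m a (slice c f)
  + serre_sum i j m.-1 a (slice i.+1 f) *+ ((c == i) && (0 < m)%N)
  + serre_sum i j m.-1 a.-1 (slice i.+1 f) *+ [&& j.+1 == i, c == j, 0 < m & 0 < a]%N
  - serre_sum i j m.-1 a.-1 (slice j.+1 f) *+ [&& i.+1 == j, c == i, 0 < m & 0 < a]%N.
Proof.
move=> nij; have nii : (i.+1 == i) = false by lia.
have njj : (j.+1 == j) = false by lia.
rewrite {1}/serre_sum raddf_sum.
(* The summands record which of the three operators change the first letter: none, one of them, or
   e_i together with an adjacent e_j. *)
transitivity (\sum_(b < a.+1) ((-1) ^+ b *: divpow j (a - b) (divpow i m (divpow j b
  (slice c f)))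
 + (-1) ^+ b *: (divpow j (a - b) (divpow i m (divpow j b.-1 (slice j.+1 f))) *+
   (0 < b)%N) *+ (c == j)
 + (-1) ^+ b *: divpow j (a - b) (divpow i m.-1 (divpow j b (slice i.+1 f))) *+
   ((c == i) && (0 < m)%N)
 + (-1) ^+ b *: (divpow j (a - b) (divpow i m.-1 (divpow j b.-1 (slice j.+1 f))) *+
   (0 < b)%N) *+ [&& i.+1 == j, c == i & 0 < m]%N
 + (-1) ^+ b *: (divpow j (a - b).-1 (divpow i m (divpow j b (slice j.+1 f))) *+
   (0 < a - b)%N) *+ (c == j)
 + (-1) ^+ b *: (divpow j (a - b).-1 (divpow i m.-1 (divpow j b (slice i.+1 f))) *+
   (0 < a - b)%N) *+ [&& j.+1 == i, c == j & 0 < m]%N)).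
  apply: eq_bigr => b _.
  rewrite /= linearZ /= !scalerMnr -!scalerDr; congr (_ *: _);
    rewrite !slice_divpow njj /= !mulr0n !addr0.
  do 3 rewrite ?(linearD, raddfMn) /=.
  rewrite ?njj ?nii /=.
  have [ci|nci] := eqVneq c i; have [cj|ncj] := eqVneq c j;
    rewrite ?andbF ?mulr0n ?addr0 //=.
  - by rewrite -ci -cj eqxx in nij.
  - case: (0 < m)%N => //=;
    rewrite ?andbT ?andbF ?mulr0n ?addr0 // ?mulr1n ?addrA -?mulrnA ?mulnb 1?andbC //.
  - have [ji|nji] := eqVneq j.+1 i; last by rewrite /= !mulr0n !addr0.
    have -> : (i.+1 == j) = false by lia.
    case: (0 < m)%N; rewrite /= ?mulr0n ?mulr1n ?addr0 ?mulrnDl ?addrA //.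
rewrite !big_split /= !sumrMnl !serre_shiftl !serre_shiftr.
rewrite -![\sum_(_ < _) _]/(serre_sum _ _ _ _ _).
rewrite !mulNrn -!mulrnA !mulnb +%R.[ACl (1*3*6*4)*(2*5)] addNr addr0.
by rewrite ![(0 < a)%N && _]andbC -!andbA.
Qed.

Lemma serre_sum_nil i j m a f : (0 < a)%N -> serre_sum i j m a f [::] = 0.
Proof.
move=> a_gt0; rewrite /serre_sum fct_sumE big1 // => b _.
rewrite -[LHS]/((-1) ^+ b *: divpow j (a - b) (divpow i m (divpow j b f)) [::]).
rewrite !divpow_nil -!mulrnA !mulnb.
have -> : [&& b == 0%N :> nat, m == 0%N & a - b == 0]%N = false by lia.
exact: scaler0.
Qed.

Definition linkn i j m : nat := if (i.+1 == j) || (j.+1 == i) then m else 0%N.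

(** Conjugation by exp(t e_j) sends e_i to e_i + t [e_j, e_i], and the commutator commutes with e_i
    and e_j. Hence the conjugate of e_i^(m) has degree at most m in t, and degree 0 if i and j are
    not adjacent; [linkn] is this bound. *)
Lemma serre (i j m a : nat) f :
  i != j -> (linkn i j m < a)%N -> serre_sum i j m a f = 0.
Proof.
move=> nij lt_a; apply/funext => x.
elim: x m a f lt_a => [|c x IH] m a f lt_a.
  by rewrite serre_sum_nil //; lia.
rewrite -[LHS]/(slice c _ x) slice_serre //.
have IHb m' a' g (b : bool) : (b -> (linkn i j m' < a')%N) ->
    (serre_sum i j m' a' g *+ b) x = 0.
  by case: b => // /(_ isT) lt; rewrite mulr1n IH.
rewrite -[LHS]/(_ x + _ x + _ x - _ x) IH //.
by do 3![rewrite IHb; last by move: lt_a; rewrite /linkn; case: ifP => ? ?; lia];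
  rewrite subr0 !addr0.
Qed.

Definition weight (la : nat -> nat) f :=
  forall x, f x != 0 -> forall l : nat, count_mem l x = la l.

(* [f] has weight la + m (eps_i - eps_(i+1)); no subtraction occurs in nat.   *)
Definition weight_shift (la : nat -> nat) i m f :=
  forall x, f x != 0 ->
  forall l : nat, (count_mem l x + m * (l == i.+1))%N = (la l + m * (l == i))%N.

Lemma divpow_weight la i m f : weight la f -> weight_shift la i m (divpow i m f).
Proof. by move=> laf x /recolor_neq0[y /divpow_count yx /laf fy] l;
  rewrite -yx fy. Qed.

End DividedPowers.

(** This is the L-fold backward difference of T |-> C(T, M); by Pascal's rule each difference lowers
    both T and M by one. *)
Lemma alternating_binomial (R : comNzRingType) L T M : (L <= T)%N ->
  \sum_(i < L.+1) (-1) ^+ i * ('C(L, i) * 'C(T - i, M))%:R =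
  (if (L <= M)%N then 'C(T - L, M - L) else 0%N)%:R :> R.
Proof.
elim: L T => [|L IH] T le_T.
  by rewrite big_ord1 bin0 !subn0 !mul1r mul1n.
rewrite big_ord_recl /= bin0 mul1n.
transitivity (\sum_(i < L.+1) (-1) ^+ i * ('C(L, i) * 'C(T - i, M))%:R
  - \sum_(i < L.+1) (-1) ^+ i * ('C(L, i) * 'C(T.-1 - i, M))%:R : R); last first.
  rewrite !IH; try lia.
  case: (ltngtP L M) => [lt_LM|lt_ML|eq_LM]; last first.
  - by rewrite -eq_LM subnn !bin0 subrr.
  - by rewrite subrr.
  have -> : (T - L = (T.-1 - L).+1)%N by lia.
  have -> : (M - L = (M - L.+1).+1)%N by lia.
  by rewrite binS natrD addrAC subrr add0r; congr ('C(_, _)%:R); lia.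
rewrite [in RHS]big_ord_recl /= bin0 mul1n -!addrA; congr (_ + _).
rewrite [X in _ - X](eq_bigr (fun i :
  'I_L.+1 => (-1) ^+ i * ('C(L, i) * 'C(T - i.+1, M))%:R)); last first.
  by move=> i _; congr (_ * (_ * 'C(_, _))%:R); lia.
rewrite big_ord_recr /= [X in _ = _ - X]big_ord_recr /= opprD addrA -sumrB /bump /=.
congr (_ + _).
  apply: eq_bigr => i _; rewrite !add1n binS mulnDl natrD exprS; ring.
rewrite !add1n !binn !mul1n exprS; ring.
Qed.

(** * Weights -1 for a simple root *)

Section RankOne.

Variable k : comNzRingType.
Notation wfun := (seq nat -> k^o).
Implicit Types (f g : wfun) (x y z : seq nat).

Variable j : nat.

Definition lower c := if c == j.+1 then j else c.

(* Identify a word with the set B of positions of its letters [j.+1], among   *)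
(* the positions of its letters [j] and [j.+1].  Then [hop n g] sums [g] over *)
(* the n-subsets of the complement of B, and [kop n g] over those of B.       *)
Notation hop := (recolor lower j j.+1).
Notation kop := (recolor lower j.+1 j.+1).

(** Inclusion-exclusion over the intersection of an n-set with B: [kop y] runs over the y-subsets Y
    of B, and [divpow j (n - y)] sums g over the n-sets containing Y. *)
Lemma hop_kop n g :
  hop n g = \sum_(y < n.+1) (-1) ^+ y *: kop y (divpow j (n - y) g).
Proof.
apply/funext => z; elim: z n g => [|c z IH] n g.
  rewrite recolor_nil fct_sumE big_ord_recl /= big1 => [|y _].
    by rewrite addr0 scale1r recolor_nil divpow_nil subn0.
  by rewrite -[LHS]/(_ *: kop _ _ [::]) recolor_nil mulr0n scaler0.
rewrite -[LHS]/(slice c _ z) -[RHS]/(slice c _ z) slice_recolor raddf_sum.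
have [lj|nlj] := eqVneq c j.+1; last first.
  have -> : lower c = c by rewrite /lower (negPf nlj).
  transitivity ((\sum_(y < n.+1) ((-1) ^+ y *: kop y (divpow j (n - y) (slice c g))
     + (-1) ^+ y *: (kop y (divpow j (n - y).-1 (slice j.+1 g)) *+
       (0 < n - y)%N) *+ (c == j))) z).
    rewrite big_split /= sumrMnl.
    rewrite (alternating_shiftl (fun u v => kop v (divpow j u (slice j.+1 g)))).
    rewrite -[LHS]/(_ z + _ z) -[RHS]/(_ z + _ z) IH; congr (_ + _).
    by rewrite andbC -mulnb mulrnA !natmulfctE IH.
  congr (_ z); apply: eq_bigr => y _.
  rewrite /= linearZ /= slice_recolor (negPf nlj) mulr0n addr0.
  have -> : lower c = c by rewrite /lower (negPf nlj).
  by rewrite slice_divpow raddfD /= scalerDr !raddfMn /= -mulrnA mulnb andbC.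
rewrite lj {c lj}; have -> : lower j.+1 = j by rewrite /lower eqxx.
have njj : (j.+1 == j) = false by lia.
rewrite njj mulr0n addr0.
transitivity ((\sum_(y < n.+1) ((-1) ^+ y *: kop y (divpow j (n - y) (slice j g))
     + (-1) ^+ y *: (kop y (divpow j (n - y).-1 (slice j.+1 g)) *+ (0 < n - y)%N)
     + (-1) ^+ y *: (kop y.-1 (divpow j (n - y) (slice j.+1 g)) *+ (0 < y)%N))) z).
  rewrite !big_split /=.
  rewrite (alternating_shiftl (fun u v => kop v (divpow j u (slice j.+1 g)))).
  rewrite (alternating_shiftr (fun u v => kop v (divpow j u (slice j.+1 g)))).
  by rewrite addrK IH.
congr (_ z); apply: eq_bigr => y _.
rewrite /= linearZ /= slice_recolor eqxx.
have -> : lower j.+1 = j by rewrite /lower eqxx.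
by rewrite !slice_divpow njj eqxx mulr0n addr0; do 3![rewrite ?(raddfD, raddfMn) /=].
Qed.

(** Fix an n-set A disjoint from B. The m positions added to B must avoid A, so they are chosen
    among [count_mem j z - n] positions. If n exceeds [count_mem j z], both sides are 0. *)
Lemma divpow_hop m n g z :
  divpow j m (hop n g) z = hop n g z *+ 'C(count_mem j z - n, m).
Proof.
elim: z m n g => [|c z IH] m n g; first by rewrite divpow_nil sub0n bin0n.
have [lt_n|le_n] := ltnP (count_mem j (c :: z)) n.
  rewrite recolor_small // mul0rn [LHS]big_seq big1 // => y /recolorings_count cy.
  by rewrite recolor_small //; have := cy j; rewrite map_id eqxx; lia.
rewrite -[LHS]/(slice c _ z) slice_divpow -[in RHS]/(slice c (hop n g) z)
  !slice_recolor.
have njj : (j.+1 == j) = false by lia.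
rewrite njj mulr0n addr0.
rewrite raddfD raddfMn /= -[LHS]/(_ z + (_ *+ _) z + (_ *+
  _) z) -[in RHS]/(_ z + (_ *+ _) z).
rewrite !natmulfctE !IH /=.
have [cj|ncj] := eqVneq c j; last by rewrite /= !mulr0n !addr0.
move: le_n; rewrite /= cj eqxx => le_n;
  have -> : lower j = j by rewrite /lower -if_neg neq_ltn ltnSn.
have -> : lower j.+1 = j by rewrite /lower eqxx.
have binE : (n <= count_mem j z)%N ->
    'C(1 + count_mem j z - n, m) = ('C(count_mem j z - n, m) +
      'C(count_mem j z - n, m.-1) * (0 < m))%N.
  by move=> ?; rewrite add1n subSn //; case: m {IH} => [|m];
    rewrite ?bin0 // binS muln1.
rewrite mulrnDl.
have -> : hop n (slice j g) z *+ 'C(1 + count_mem j z - n, m) =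
   hop n (slice j g) z *+ ('C(count_mem j z - n, m) +
     'C(count_mem j z - n, m.-1) * (0 < m))%N.
  by have [/binE ->|lt_n] := leqP n (count_mem j z); rewrite // recolor_small ?mul0rn.
have -> : (hop n.-1 (slice j.+1 g) z *+ 'C(count_mem j z - n.-1, m)) *+ (0 < n)%N =
  (hop n.-1 (slice j.+1 g) z *+ (0 < n)%N) *+ 'C(1 + count_mem j z - n, m).
  by case: n {le_n binE IH} => [|n]; rewrite ?mulr0n ?mul0rn // mulr1n add1n subSS.
by rewrite mulrnDr mulrnA addrAC.
Qed.

(* Apply [hop_kop] with n = count_mem j z to the word z obtained from x by    *)
(* swapping [j] and [j.+1]: hop evaluates f at x, and kop is 0 for y > n - s. *)
Lemma divpow_inj s f : (0 < s)%N ->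
  (forall x, f x != 0 -> count_mem j.+1 x = (count_mem j x + s)%N) ->
  (forall a, (s <= a)%N -> divpow j a f = 0) -> f = 0.
Proof.
move=> s_gt0 fs f0; apply/funext => x; apply/eqP/negPn/negP => fx.
have cx := fs x fx; move/negP: fx; apply; apply/eqP.
pose sw c := if c == j then j.+1 else lower c.
have swK : cancel sw sw.
  move=> c; rewrite /sw /lower; case: (eqVneq c j) => [->|nc].
    by rewrite eqxx gtn_eqF.
  by case: (eqVneq c j.+1) => [->|nc1]; rewrite ?eqxx // (negPf nc) (negPf nc1).
have csw c : count_mem c (map sw x) = count_mem (sw c) x.
  by rewrite count_map; apply: eq_count => d /=; rewrite -(inj_eq (can_inj swK)) swK.
have swj : sw j = j.+1 by rewrite /sw eqxx.
have swj1 : sw j.+1 = j by rewrite /sw /lower eqxx gtn_eqF.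
have -> : f x = hop (count_mem j (map sw x)) f (map sw x).
  by rewrite recolor_all -map_comp; congr f; rewrite -[LHS]map_id; apply: eq_map => c;
     rewrite /= -/(sw _) swK.
rewrite hop_kop fct_sumE big1 // => y _.
rewrite -[LHS]/(_ *: kop _ _ _).
have [le_s|lt_s] := leqP s (count_mem j (map sw x) - y).
  by rewrite f0 // raddf0 scaler0.
rewrite recolor_small ?scaler0 //.
by move: lt_s; move: (nat_of_ord y) => n; rewrite !csw swj swj1; lia.
Qed.

(* For b = mu (j+1), a b-set B has a complement C of size b - 1, and B is the *)
(* only b-set disjoint from C; so inclusion-exclusion over the subsets of C   *)
(* recovers u(B) from w.                                                      *)
Lemma divpow_lift (mu : nat -> nat) (w : nat -> wfun) : mu j.+1 = (mu j).+1 ->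
  (forall m, (0 < m)%N -> weight_shift mu j m (w m)) ->
  (forall a m, (0 < m)%N -> divpow j a (w m) = w (a + m)%N *+ 'C(a + m, a)) ->
  exists2 u, weight mu u & forall m, (0 < m)%N -> divpow j m u = w m.
Proof.
move=> mu_j wt_w cw; set b := mu j.+1.
(* For a solution u, the value of W at a set of fewer than b positions is the sum of u over the
   b-sets containing it. *)
pose W : wfun := fun z => if (count_mem j.+1 z < b)%N then w (b - count_mem j.+1
  z)%N z else 0.
pose U : wfun := \sum_(n < b) (-1) ^+ n *: hop n W.
pose u : wfun := fun x => if `[< forall l :
  nat, count_mem l x = mu l >] then U x else 0.
exists u => [x | m m_gt0].
  by rewrite /u; case: asboolP => // _; rewrite eqxx.
apply/funext => z.
have [wt_z|wt_z] := pselect (forall l :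
  nat, (count_mem l z + m * (l == j.+1))%N = (mu l + m * (l == j))%N); last first.
  transitivity (0 : k^o); last first.
    apply/esym/eqP/negPn/negP => nz; apply: wt_z; exact: wt_w nz.
  rewrite [LHS]big_seq big1 // => y /divpow_count yz.
  rewrite /u; case: asboolP => // wt_y; case: wt_z => l.
  by rewrite -yz wt_y.
transitivity (divpow j m U z).
  apply: eq_recolor => y /divpow_count yz; rewrite /u; case: asboolP => // -[] l.
  by have := yz l; rewrite wt_z; lia.
have cz : count_mem j z = (b.-1 + m)%N.
  by have := wt_z j; rewrite eqxx (ltn_eqF (ltnSn j)) muln0 addn0 muln1 /b mu_j => ->.
have cz1 : (count_mem j.+1 z + m)%N = b.
  by have := wt_z j.+1; rewrite eqxx (gtn_eqF (ltnSn j)) muln0 addn0 muln1.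
have njj1 : (j.+1 == j) = false := gtn_eqF (ltnSn j).
have kopW (n y : nat) : (y <= n < b)%N ->
    kop y (divpow j (n - y) W) z = kop y (w (b - y)%N) z *+ 'C(b - y, n - y).
  move=> /andP[le_yn lt_nb].
  transitivity (kop y (w (b - y)%N *+ 'C(b - y, n - y)) z);
    last by rewrite raddfMn natmulfctE.
  apply: eq_recolor => z0 /recolorings_count/(_ j.+1).
  have -> : (j.+1 == lower j.+1) = false by rewrite /lower eqxx.
  have -> : count_mem j.+1 (map lower z) = 0%N.
    by rewrite count_map; apply/eqP; rewrite -leqn0 leqNgt -has_count;
       apply/hasPn => c _ /=; rewrite /lower; case: (eqVneq c j.+1) => // _;
         rewrite ltn_eqF.
  rewrite eqxx muln0 muln1 addn0 => cz0.
  transitivity (divpow j (n - y) (w (b - n)%N) z0).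
    apply: eq_recolor => z1 /divpow_count/(_ j.+1).
    rewrite njj1 eqxx muln0 muln1 addn0 cz0 add0n subnKC // => cz1'.
    by rewrite /W cz1' lt_nb.
  by rewrite cw ?subn_gt0 //; congr ((w _ *+ 'C(_, _)) z0); lia.
have hopW (n : 'I_b) : hop n W z =
    \sum_(y < b | (y <= n)%N) (-1) ^+ y * kop y (w (b - y)%N) z *+ 'C(b - y, n - y).
  rewrite hop_kop fct_sumE (big_ord_widen _ (fun y :
    nat => ((-1) ^+ y *: kop y (divpow j (n - y) W)) z) (ltn_ord n)).
  apply: eq_bigr => y le_yn; rewrite -[LHS]/((-1) ^+ y * kop y _ z) kopW ?mulrnAr //.
  by rewrite -ltnS le_yn ltn_ord.
rewrite raddf_sum fct_sumE.
transitivity (\sum_(n < b) (-1) ^+ n * (hop n W z *+ 'C(b.-1 + m - n, m))).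
  by apply: eq_bigr => n _; rewrite -cz -divpow_hop /= linearZ.
transitivity (\sum_(y < b) (-1) ^+ y * kop y (w (b - y)%N) z *
    \sum_(n < b | (y <= n)%N) (-1) ^+ n * ('C(b - y, n - y) * 'C(b.-1 +
      m - n, m))%:R).
  under eq_bigr => n _ do rewrite hopW -sumrMnl mulr_sumr.
  rewrite (exchange_big_dep predT) //=; apply: eq_bigr => y _.
  move: (kop y _ z) => K; rewrite mulr_sumr; apply: eq_bigr => n _.
  by rewrite -mulrnA -[in LHS]mulr_natr mulrCA.
have le_mb : (b - m < b)%N by lia.
(* This is [alternating_binomial] with L = b - y, T = b - 1 + m - y and M = m; its last term, absent
   here, is a multiple of C(m - 1, m) = 0. *)
have inner (y : nat) : (y < b)%N -> (m <= b - y)%N ->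
    \sum_(n < b | (y <= n)%N) (-1) ^+ n * ('C(b - y, n - y) * 'C(b.-1 + m - n, m))%:R
    = (-1) ^+ y * (m == b - y)%N%:R :> k^o.
  move=> lt_yb le_m; have le_LT : (b - y <= b.-1 + m - y)%N by lia.
  have := alternating_binomial (k^o : comNzRingType) m le_LT;
    rewrite big_ord_recr /= binn mul1n.
  rewrite ['C(_ - (b - y), m)]bin_small; last by lia.
  rewrite mulr0 addr0 => sumE.
  transitivity (\sum_(y <= n < b) (-1) ^+ n * ('C(b - y, n - y) * 'C(b.-1 +
    m - n, m))%:R : k^o).
    by rewrite big_geq_mkord.
  rewrite -{1}[y]add0n big_addn big_mkord.
  transitivity ((-1) ^+ y * \sum_(i < b - y) (-1) ^+ i * ('C(b - y, i) *
    'C(b.-1 + m - y - i, m))%:R : k^o).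
    rewrite mulr_sumr; apply: eq_bigr => i _.
    by rewrite addnK exprD mulrCA !mulrA subnDA subnAC.
  rewrite sumE; congr (_ * _%:R); case: (ltngtP m (b - y)) le_m => // -> _.
  by rewrite ?leqnn subnn bin0.
(* Only y = b - m survives: smaller y vanish by [inner], and for larger y the word z has too few
   letters [j.+1] for [kop y]. *)
rewrite (bigD1 (Ordinal le_mb) isT) /= [X in _ + X]big1 => [|y neq_y]; last first.
  have [le_ym|lt_my] := leqP m (b - y).
    rewrite inner // (_ : (m == b - y)%N = false) ?mulr0 //.
    by apply/negbTE; apply: contra neq_y => /eqP my; apply/eqP/val_inj;
      rewrite /= my; have := ltn_ord y; lia.
  by rewrite recolor_small ?mulr0 ?mul0r //; lia.
have le_mb' : (m <= b)%N by lia.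
rewrite addr0 inner ?subKn // eqxx mulr1 mulrAC -expr2 sqrr_sign mul1r.
have -> : (b - m)%N = count_mem j.+1 z by lia.
rewrite recolor_all; congr (w m _); rewrite -[RHS]map_id; apply: eq_map => c.
by rewrite /lower; case: eqP.
Qed.

End RankOne.

(** * Lifting cocycles *)

Section Cocycles.

Variable k : comNzRingType.
Notation wfun := (seq nat -> k^o).
Implicit Types (f g u : wfun) (w : nat -> nat -> wfun) (la mu : nat -> nat).

(* The relations satisfied by [w i m = divpow i m u], u of weight la. *)
Record cocycle la w : Prop := Cocycle {
  cocycle_weight : forall i m, (0 < m)%N -> weight_shift la i m (w i m);
  cocycle_comp : forall i a m, (0 < m)%N ->
    divpow i a (w i m) = w i (a + m)%N *+ 'C(a + m, a);
  cocycle_serre : forall i j m a : nat, i != j -> (0 < m)%N -> (linkn i j m < a)%N ->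
    divpow j a (w i m) +
      \sum_(b < a) (-1) ^+ b.+1 *: divpow j (a - b.+1) (divpow i m (w j b.+1)) = 0 }.

Lemma weight_shiftB la i m f g :
  weight_shift la i m f -> weight_shift la i m g -> weight_shift la i m (f - g).
Proof.
move=> wf wg x fg; have [/eqP fx|/wf //] := boolP (f x == 0).
by apply: wg; apply: contra_neq fg => gx; rewrite -[LHS]/(f x - g x) fx gx subr0.
Qed.

Lemma weightD la f g : weight la f -> weight la g -> weight la (f + g).
Proof.
move=> wf wg x fg; have [/eqP fx|/wf //] := boolP (f x == 0).
by apply: wg; apply: contra_neq fg => gx; rewrite -[LHS]/(f x + g x) fx gx addr0.
Qed.

Lemma weightB la f g : weight la f -> weight la g -> weight la (f - g).
Proof.
move=> wf wg; apply: weightD => // x ng; apply: wg; apply: contra_neq ng => gx.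
by rewrite -[LHS]/(- g x) gx oppr0.
Qed.

Lemma cocycle_divpow la u : weight la u -> cocycle la (fun i m => divpow i m u).
Proof.
move=> wu; split=> [i m _|i a m _|i j m a nij _ lt_a].
- exact: divpow_weight.
- exact: divpow_comp.
have := serre u nij lt_a; rewrite /serre_sum big_ord_recl /= scale1r subn0.
by rewrite divpow0.
Qed.

Lemma cocycleB la w w' : cocycle la w -> cocycle la w' ->
  cocycle la (fun i m => w i m - w' i m).
Proof.
move=> [w1 w2 w3] [w1' w2' w3']; split=> [i m m0|i a m m0|i j m a nij m0 lt_a].
- by apply: weight_shiftB; [apply: w1 | apply: w1'].
- by rewrite raddfB /= w2 // w2' // mulrnBl.
have := congr2 (fun f g => f - g) (w3 i j m a nij m0 lt_a) (w3' i j m a nij m0 lt_a).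
rewrite /= subrr => E; apply: etrans E; rewrite opprD addrACA -sumrB raddfB;
  congr (_ + _).
by apply: eq_bigr => b _; rewrite -scalerBr -!raddfB.
Qed.

(* When <mu, alpha_j> = -1 the components for j determine the others, since   *)
(* e_j acts injectively on the weights involved.                              *)
Lemma cocycle_lift_singular mu w j : mu j.+1 = (mu j).+1 -> cocycle mu w ->
  exists2 u, weight mu u & forall i m, (0 < m)%N -> divpow i m u = w i m.
Proof.
move=> mu_j [w1 w2 w3].
have [u wu uj] := divpow_lift mu_j (w1 j) (w2 j).
exists u => // i m m0; have [->|nij] := eqVneq i j; first exact: uj.
apply/eqP; rewrite -subr_eq0; apply/eqP.
have wv := weight_shiftB (divpow_weight (i := i) (m := m) wu) (w1 i m m0).
(* In weight mu + m (eps_i - eps_(i+1)) the letters [j.+1] outnumber the letters [j] by 1, or by 1 +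
   m when i and j are adjacent. The Serre relations kill e_j^(a) of the difference exactly from this
   a on. *)
apply: (divpow_inj (j := j) (s := (linkn i j m).+1)) => // [x /wv cx | a lt_a].
  have := cx j; have := cx j.+1; rewrite eqSS mu_j /linkn.
  rewrite [j == i]eq_sym (negPf nij) [j == i.+1]eq_sym.
  by case: (eqVneq i.+1 j) => [<-|_]; case: (eqVneq j.+1 i) => //= *; lia.
have := w3 i j m a nij m0 lt_a; have := serre u nij lt_a.
rewrite /serre_sum big_ord_recl /= scale1r subn0 divpow0 raddfB /= => s0 /esym w0.
rewrite -[X in _ - X](addrK (\sum_(b < a) (-1) ^+ b.+1 *: divpow j (a - b.+1)
  (divpow i m (w j b.+1)))).
rewrite -w0 sub0r opprK -[RHS]s0; congr (_ + _); apply: eq_bigr => b _.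
by rewrite uj.
Qed.

Definition pred_at la j : nat -> nat := fun l => (la l - (l == j))%N.

Lemma weight_shift_slice la i m f j : (0 < la j)%N ->
  weight_shift la i m f -> weight_shift (pred_at la j) i m (slice j f).
Proof.
move=> laj wf x /wf fx l; have := fx l; rewrite /pred_at /= eq_sym.
by case: (eqVneq l j) => [->|_]; lia.
Qed.

Lemma weight_slice la f j : (0 < la j)%N -> weight la f ->
  weight (pred_at la j) (slice j f).
Proof. by move=> laj wf x /wf fx l; rewrite /pred_at -fx /= eq_sym addKn. Qed.

Section Peel.

Variable la : nat -> nat.
Hypothesis la_anti : forall i, (la i.+1 <= la i)%N.

(** A word of weight la + m (eps_i - eps_(i+1)) needs la (i+1) >= m > 0, hence la i > 0 by
    dominance; so it contains no letter outside the support of la. *)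
Lemma weight_shift_slice0 i m f j :
  la j = 0%N -> (0 < m)%N -> weight_shift la i m f -> slice j f = 0.
Proof.
move=> laj m0 wf; apply/funext => x; apply/eqP/negPn/negP => /wf fx.
have := fx j; have := fx i.+1; rewrite /= !eqxx laj.
have [eji|nji] := eqVneq j i; last by lia.
by have := la_anti i; move: laj; rewrite eji (gtn_eqF (ltnSn i)) => ->; lia.
Qed.

Lemma weight_slice0 f j : la j = 0%N -> weight la f -> slice j f = 0.
Proof.
move=> laj wf; apply/funext => x; apply/eqP/negPn/negP => /wf/(_ j).
by rewrite /= eqxx laj.
Qed.

Lemma pred_at_anti j : (la j.+1 < la j)%N ->
  forall i, (pred_at la j i.+1 <= pred_at la j i)%N.
Proof.
move=> lt_j i; rewrite /pred_at; have := la_anti i.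
by case: (eqVneq i j) => [->|_]; lia.
Qed.

Lemma sum_pred_at n j : (j < n)%N -> (0 < la j)%N ->
  (\sum_(i < n) pred_at la j i).+1 = \sum_(i < n) la i.
Proof.
move=> lt_jn laj; rewrite !(bigD1 (Ordinal lt_jn) isT) /= /pred_at eqxx.
rewrite (eq_bigr (fun i : 'I_n => la i)) => [|i /negPf nij].
  by rewrite subn1 -addSn prednK.
by rewrite -[(i == j :> nat)]/(i == Ordinal lt_jn) nij subn0.
Qed.

End Peel.

Definition vanish_above j f := forall a, (j < a)%N -> slice a f = 0.

Lemma vanish_above_divpow j i m f : vanish_above j f -> vanish_above j (divpow i m f).
Proof.
move=> fj a lt_ja; rewrite slice_divpow fj // raddf0 add0r.
have [eai|_] := eqVneq a i; last by rewrite mulr0n.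
by rewrite fj ?raddf0 ?mul0rn // -eai ltnW.
Qed.

(** Raising the first letter j would lead to words beginning with [j.+1], where f vanishes. So on
    the top layer of the flag the operators act on the remaining letters only. *)
Lemma slice_divpow_top j i m f :
  vanish_above j f -> slice j (divpow i m f) = divpow i m (slice j f).
Proof.
move=> fj; rewrite slice_divpow; have [<-|_] := eqVneq j i;
  last by rewrite mulr0n addr0.
by rewrite (fj j.+1) // raddf0 mul0rn addr0.
Qed.

Lemma cocycle_slice la w j : (0 < la j)%N -> cocycle la w ->
  (forall i m, (0 < m)%N -> vanish_above j (w i m)) ->
  cocycle (pred_at la j) (fun i m => slice j (w i m)).
Proof.
move=> laj [w1 w2 w3] wj; split=> [i m m0|i a m m0|i l m a nil m0 lt_a].
- exact/weight_shift_slice/w1.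
- by rewrite -slice_divpow_top ?w2 ?raddfMn //; exact: wj.
have /(congr1 (slice j)) := w3 i l m a nil m0 lt_a.
rewrite raddf0 raddfD raddf_sum /= slice_divpow_top => [E|]; last exact: wj.
apply: etrans E; congr (_ + _); apply: eq_bigr => b _.
by rewrite linearZ /= !slice_divpow_top //; do ?apply: vanish_above_divpow; exact: wj.
Qed.

Definition prepend j f : wfun :=
  fun x => if x is c :: z then (if c == j then f z else 0) else 0.

Lemma slice_prepend j f a : slice a (prepend j f) = if a == j then f else 0.
Proof. by rewrite /slice /=; case: ifP. Qed.

Lemma vanish_above_prepend j f : vanish_above j (prepend j f).
Proof. by move=> a lt_ja; rewrite slice_prepend gtn_eqF. Qed.

Lemma weight_prepend la j f :
  (0 < la j)%N -> weight (pred_at la j) f -> weight la (prepend j f).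
Proof.
move=> laj wf [|c x] /=; first by rewrite eqxx.
case: ifP => [/eqP ->|]; last by rewrite eqxx.
move=> /wf fx l; rewrite fx /pred_at eq_sym.
by case: (eqVneq l j) => [->|_]; lia.
Qed.

(* Ext^1_B(K_la, E^d) = 0 for dominant la, where E^d is the tensor power:     *)
(* filter one factor E by its B-stable flag and use induction on d.           *)
Lemma cocycle_lift n d la w : (forall i, la i.+1 <= la i)%N ->
  (forall i, (n <= i)%N -> la i = 0%N) -> \sum_(i < n) la i = d ->
  cocycle la w ->
  exists2 u, weight la u & forall i m, (0 < m)%N -> divpow i m u = w i m.
Proof.
elim/ltn_ind: d la w => d IH la w la_anti la0 sum_la cw.
suff [u wu uw] : exists2 u, weight la u & forall i m, (0 < m)%N ->
    forall a, (0 <= a)%N -> slice a (w i m - divpow i m u) = 0.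
  exists u => // i m m0; apply/eqP; rewrite eq_sym -subr_eq0; apply/eqP.
  apply: wfunP => [|a]; last by rewrite uw.
  have [wt _ _] := cocycleB cw (cocycle_divpow wu).
  apply/eqP/negPn/negP => /(wt _ _ m0)/(_ i).
  by rewrite eqxx (ltn_eqF (ltnSn i)) muln0 muln1 /=; lia.
(* Downward induction on j: u is corrected until the difference vanishes on all words with first
   letter at least j. *)
suff /(_ n 0%N) : forall t j, (n - j)%N = t -> (j <= n)%N ->
    exists2 u, weight la u & forall i m, (0 < m)%N ->
      forall a, (j <= a)%N -> slice a (w i m - divpow i m u) = 0.
  by apply=> //; rewrite subn0.
elim=> [|t IHt] j nj le_jn.
  exists 0 => [x|i m m0 a le_ja]; first by rewrite eqxx.
  have an : (n <= a)%N by lia.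
  rewrite raddf0 subr0; have [w1 _ _] := cw.
  exact: (weight_shift_slice0 la_anti (la0 a an) m0 (w1 i m m0)).
have lt_jn : (j < n)%N by lia.
have [|u wu uw] := IHt j.+1 _ lt_jn; first by lia.
pose v i m := w i m - divpow i m u.
have cv : cocycle la v := cocycleB cw (cocycle_divpow wu).
have vj i m : (0 < m)%N -> vanish_above j (v i m) by move=> m0 a; exact: uw.
have [laj|] := posnP (la j).
  exists u => // i m m0 a; rewrite leq_eqVlt => /orP[/eqP <-|/uw -> //].
  by have [v1 _ _] := cv; exact: (weight_shift_slice0 la_anti laj m0 (v1 i m m0)).
move=> laj; have cvj := cocycle_slice laj cv vj.
have [u' wu' u'v] : exists2 u', weight (pred_at la j) u' &
    forall i m, (0 < m)%N -> divpow i m u' = slice j (v i m).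
  (* If la (j+1) = la j, removing one j produces the singular weight of [cocycle_lift_singular];
     otherwise it produces a smaller partition. *)
  have := la_anti j; rewrite leq_eqVlt => /orP[/eqP eq_j|lt_j].
    apply: (cocycle_lift_singular (j := j)) => //.
    by rewrite /pred_at eq_j eqxx (gtn_eqF (ltnSn j)); lia.
  apply: (IH (\sum_(i < n) pred_at la j i)) => //.
  - by rewrite -sum_la -(sum_pred_at lt_jn laj).
  - exact: pred_at_anti.
  - by move=> i /la0; rewrite /pred_at => ->.
exists (u + prepend j u') => [|i m m0 a le_ja].
  exact/weightD/weight_prepend.
have -> : w i m - divpow i m (u + prepend j u') = v i m - divpow i m (prepend j u').
  by rewrite /v -addrA -opprD -raddfD.
rewrite raddfB /=.
move: le_ja; rewrite leq_eqVlt => /orP[/eqP <-|lt_ja].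
  rewrite slice_divpow_top; last exact: vanish_above_prepend.
  by rewrite slice_prepend eqxx u'v // subrr.
have uj : vanish_above j (divpow i m (prepend j u')).
  exact/vanish_above_divpow/vanish_above_prepend.
by rewrite vj // uj // subrr.
Qed.

End Cocycles.

(** * Specht modules as common kernels *)

Section WordPermutation.

Variable d : nat.
Implicit Types (s : 'S_d) (x y : seq nat).

Definition permw s x : seq nat := [seq nth 0%N x (s a) | a <- enum 'I_d].

Lemma size_permw s x : size (permw s x) = d.
Proof. by rewrite size_map size_enum_ord. Qed.

Lemma nth_permw s x (a : 'I_d) : nth 0%N (permw s x) a = nth 0%N x (s a).
Proof. by rewrite (nth_map a) ?size_enum_ord // nth_ord_enum. Qed.

Lemma eq_words x y : size x = d -> size y = d ->
  (forall a : 'I_d, nth 0%N x a = nth 0%N y a) -> x = y.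
Proof.
move=> sx sy xy; apply: (@eq_from_nth _ 0%N) => [|a]; rewrite sx ?sy // => lt_a.
exact: (xy (Ordinal lt_a)).
Qed.

Lemma permwM s s' x : permw s (permw s' x) = permw (s * s')%g x.
Proof.
apply: eq_words => [||a]; rewrite ?size_permw //.
by rewrite !nth_permw permM.
Qed.

Lemma permw1 x : size x = d -> permw 1%g x = x.
Proof. by move=> sx; apply: eq_words => [||a];
  rewrite ?size_permw // nth_permw perm1. Qed.

Lemma perm_permw s x : size x = d -> perm_eq (permw s x) x.
Proof.
move=> sx.
have -> : permw s x = map (fun a : 'I_d => nth 0%N x a) (map s (enum 'I_d)).
  by rewrite -map_comp.
rewrite -[X in perm_eq _ X](mkseq_nth 0%N) /mkseq sx -val_enum_ord -map_comp.
apply: perm_map; apply: uniq_perm.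
- by rewrite map_inj_uniq ?enum_uniq //; exact: perm_inj.
- exact: enum_uniq.
move=> a; rewrite mem_enum; apply/mapP; exists (s^-1 a)%g; rewrite ?mem_enum //.
by rewrite permKV.
Qed.

End WordPermutation.

Lemma perm_eq_permw d (x y : seq nat) :
  size x = d -> perm_eq x y -> exists s : 'S_d, y = permw s x.
Proof.
move=> sx xy; have sy : size y = d by rewrite -(perm_size xy).
pose tx := tcast sx (in_tuple x); pose ty := tcast sy (in_tuple y).
have/tuple_permP[s ys] : perm_eq ty tx by rewrite perm_sym !val_tcast.
exists s; move: ys; rewrite val_tcast /= => ->.
by apply: eq_map => a; rewrite (tnth_nth 0%N) val_tcast.
Qed.

Section Equivariance.

Variable k : comNzRingType.
Notation wfun := (seq nat -> k^o).
Implicit Types (f g u : wfun) (x y : seq nat).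

Notation raises i m := (recolorings id i i.+1 m).

Definition raise_letter (i : nat) (p :
  nat * nat) := (p.2 == p.1) || ((p.1 == i) && (p.2 == i.+1)).

Lemma count_raise i x y : size y = size x -> all (raise_letter i) (zip x y) ->
  (count_mem i.+1 x <= count_mem i.+1 y)%N.
Proof.
elim: x y => [|a x IH] [|b y] //= [/IH le_xy] /andP[ab /le_xy].
by case/orP: ab => [/eqP /= ->|/andP[/= /eqP -> /eqP ->]];
  rewrite ?eqxx ?(ltn_eqF (ltnSn i)); lia.
Qed.

(** A description letter by letter, independent of the order of positions, from which compatibility
    with permutations follows. *)
Lemma mem_raises i m x y : (y \in raises i m x) =
  [&& size y == size x,
      all (raise_letter i) (zip x y)
    & count_mem i.+1 y == (count_mem i.+1 x + m)%N].
Proof.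
elim: x y m => [|a x IH] [|b y] m //=.
- by case: m.
- by case: m.
- by rewrite mem_cat; apply/negbTE/negP => /orP[/mapP[]//|];
  case: ifP => // _ /mapP[].
rewrite mem_cat.
have consE c L : (b :: y \in map (cons c) L) = (b == c) && (y \in L).
  apply/mapP/andP => [[z zL [-> ->]]|[/eqP -> yL]]; first by rewrite eqxx.
  by exists y.
rewrite consE IH eqSS.
have -> : (b :: y \in (if (a == i) && (0 < m)%N then map (cons i.+1) (raises i m.-1
  x) else [::]))
   = [&& (a == i) && (0 < m)%N, b == i.+1 & y \in raises i m.-1 x].
  by case: ifP => //= _; rewrite consE.
rewrite IH.
case: (eqVneq (size y) (size x)) => /= [sxy|_]; last by rewrite !andbF.
have := @count_raise i _ _ sxy; case: (all _ _) => /= [/(_ isT) le_xy|_];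
  last by rewrite !andbF.
rewrite andbT /raise_letter /=; case: (eqVneq b a) => [->|nba] /=.
  rewrite -addnA eqn_add2l; case: eqP => //= _; case: (eqVneq a i) => [->|] //=.
  by rewrite (ltn_eqF (ltnSn i)) andbF.
case: (eqVneq a i) => //= eai; case: (eqVneq b i.+1) => [ebi|] /=;
  last by rewrite andbF.
by rewrite eai (ltn_eqF (ltnSn i)); case: m => [|m] /=; lia.
Qed.

Lemma raises_uniq i m x : uniq (raises i m x).
Proof.
elim: x m => [|a x IH] m /=; first by case: ifP.
have cons_inj c : injective (@cons nat c) by move=> ? ? [].
rewrite cat_uniq map_inj_uniq // IH /=; case: ifP => //= /andP[/eqP -> _].
rewrite map_inj_uniq // IH andbT; apply/hasPn => _ /mapP[y _ ->].
by apply/negP => /mapP[z _ [/eqP]]; rewrite (gtn_eqF (ltnSn i)).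
Qed.

Variable d : nat.
Implicit Types s : 'S_d.

Lemma raises_permw i m s x : size x = d ->
  perm_eq (map (permw s) (raises i m x)) (raises i m (permw s x)).
Proof.
move=> sx.
have sz y : y \in raises i m x -> size y = d by rewrite mem_raises sx => /andP[/eqP].
apply: uniq_perm; rewrite ?raises_uniq //.
  rewrite map_inj_in_uniq ?raises_uniq // =>
    y z /sz sy /sz szz /(congr1 (permw s^-1)).
  by rewrite !permwM mulVg !permw1.
have sub s' z : size z = d -> forall y, y \in raises i m z ->
  permw s' y \in raises i m (permw s' z).
  move=> szz y; rewrite !mem_raises !size_permw eqxx /= =>
    /and3P[/eqP sy /all_nthP yz cy].
  rewrite szz in sy; apply/andP; split.
    apply/(all_nthP (0, 0)%N) => a; rewrite size_zip !size_permw minnn => lt_a.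
    have := yz (0, 0)%N (s' (Ordinal lt_a)).
    by rewrite size_zip szz sy minnn ltn_ord !nth_zip ?size_permw ?szz ?sy //=
      -!nth_permw; apply.
  by rewrite !(seq.permP (perm_permw _ _)) ?sy ?szz.
move=> y; apply/mapP/idP => [[z zx ->]|yx]; first exact: sub.
have sy : size y = d by move: yx; rewrite mem_raises size_permw => /andP[/eqP].
exists (permw s^-1 y); last by rewrite permwM mulgV permw1.
by have := sub s^-1%g _ (size_permw s x) _ yx; rewrite permwM mulVg permw1.
Qed.

Lemma divpow_permw i m s f x : size x = d ->
  divpow i m (fun y => f (permw s y)) x = divpow i m f (permw s x).
Proof.
by move=> sx; rewrite /divpow /recolor -(perm_big _ (raises_permw i m s sx)) big_map.
Qed.

End Equivariance.

(* A tableau is given by the rows R and the columns C of its entries. *)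
Definition istab (la : nat -> nat) (R C : seq nat) : Prop :=
  [/\ size C = size R, uniq (zip R C) & forall r c, ((r, c) \in zip R C) =
    (c < la r)%N].

Section Polytabloids.

Variable k : comNzRingType.
Notation wfun := (seq nat -> k^o).
Implicit Types (f g u : wfun) (x y R C : seq nat) (la : nat -> nat).

(* Expanding the determinant gives the signed sum over the column stabilizer. *)
Definition ptab_mx R C x : 'M[k]_(size R) :=
  \matrix_(a, b) ((nth 0%N C a == nth 0%N C b) && (nth 0%N x a == nth 0%N R b))%:R.

Definition ptab R C : wfun :=
  fun x => if size x == size R then \det (ptab_mx R C x) else 0.

Lemma ptab_neq0 R C x : ptab R C x != 0 ->
  size x = size R /\ exists s : 'S_(size R), forall a : 'I_(size R),
    nth 0%N C a = nth 0%N C (s a) /\ nth 0%N x a = nth 0%N R (s a).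
Proof.
rewrite /ptab; case: (eqVneq (size x)) => [sx nz|_]; last by rewrite eqxx.
split=> //; apply: contrapT => no_s; move/eqP: nz; apply.
apply: big1 => s _.
have [a nCR] : exists a : 'I_(size R),
  ~~ ((nth 0%N C a == nth 0%N C (s a)) && (nth 0%N x a == nth 0%N R (s a))).
  apply: contrapT => all_a; apply: no_s; exists s => a.
  have [/andP[/eqP -> /eqP ->] //|nCR] :=
    boolP ((nth 0%N C a == nth 0%N C (s a)) && (nth 0%N x a == nth 0%N R (s a))).
  by case: all_a; exists a.
by rewrite (bigD1 a) //= mxE (negPf nCR) mul0r mulr0.
Qed.

Lemma ptab_permw R C (s : 'S_(size R)) x :
  (forall a : 'I_(size R), nth 0%N C (s a) = nth 0%N C a) -> size x = size R ->
  ptab R C (permw s x) = (-1) ^+ s * ptab R C x.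
Proof.
move=> Cs sx; rewrite /ptab size_permw sx eqxx -det_perm -det_mulmx; congr (\det _).
by rewrite -row_permE; apply/matrixP => a b; rewrite !mxE nth_permw Cs.
Qed.

Lemma istab_mem la R C : istab la R C ->
  forall r c, reflect (exists2 a :
    'I_(size R), nth 0%N R a = r & nth 0%N C a = c) (c < la r)%N.
Proof.
move=> [sC _ RC] r c; rewrite -RC; apply: (iffP (nthP (0, 0)%N)) => [[a]|[a <- <-]].
  rewrite size_zip sC minnn => lt_a; rewrite nth_zip ?sC // => -[<- <-].
  by exists (Ordinal lt_a).
by exists a; rewrite ?size_zip ?sC ?minnn // nth_zip.
Qed.

(** If x has two letters i in one column, swapping them fixes x but changes the sign of the value,
    which is then 0 as 2 is regular. Otherwise each term vanishes: a raised letter i+1 lies in a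
    column that also has a cell in row i, and the entry y places there has letter i in x too, giving
    two letters i in that column. *)
Lemma divpow_ptab la R C i m : GRing.lreg (2%:R : k) ->
  (forall i, la i.+1 <= la i)%N -> istab la R C -> (0 < m)%N ->
  divpow i m (ptab R C) = 0.
Proof.
move=> reg2 la_anti tabRC m0; apply/funext => x.
have [sx|nsx] := eqVneq (size x) (size R); last first.
  rewrite [LHS]big_seq big1 // => y; rewrite mem_raises => /andP[/eqP sy _].
  by rewrite /ptab sy (negPf nsx).
have [[a [b [nab Cab xa xb]]]|no_ab] := pselect (exists a b : 'I_(size R),
    [/\ a != b, nth 0%N C a = nth 0%N C b, nth 0%N x a = i & nth 0%N x b = i]).
  pose s := tperm a b.
  have Cs (c : 'I_(size R)) : nth 0%N C (s c) = nth 0%N C c.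
    by rewrite /s; case: tpermP => [->|->|].
  have xs : permw s x = x.
    apply: eq_words => [||c]; rewrite ?size_permw // nth_permw /s.
    by case: tpermP => [->|->|]; rewrite ?xa ?xb.
  have dN : divpow i m (ptab R C) x = - divpow i m (ptab R C) x.
    rewrite -{1}xs -divpow_permw //.
    transitivity (divpow i m (- ptab R C) x); last by rewrite raddfN.
    apply: eq_recolor => y; rewrite mem_raises sx => /andP[/eqP sy _].
    by rewrite ptab_permw // odd_tperm nab mulN1r.
  apply: reg2; rewrite mulr0 mulr_natl mulr2n {1}dN; exact: addNr.
rewrite [LHS]big_seq big1 // => y;
  rewrite mem_raises sx => /and3P[/eqP sy /all_nthP yx cy].
apply/eqP/negPn/negP => /ptab_neq0[_ [s Rs]]; apply: no_ab.
have rel (a : 'I_(size R)) : raise_letter i (nth 0%N x a, nth 0%N y a).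
  by have := yx (0, 0)%N a; rewrite size_zip sx sy minnn nth_zip ?sx ?sy //; apply.
have [a nya] : exists a : 'I_(size R), nth 0%N y a != nth 0%N x a.
  apply: contrapT => eq_yx.
  have eyx : y = x.
    by apply: eq_words sy sx _ => a; apply/eqP/negPn/negP => nya; apply: eq_yx;
      exists a.
  by move: cy; rewrite eyx -{1}[count_mem i.+1 x]addn0 eqn_add2l eq_sym (gtn_eqF m0).
have := rel a; rewrite /raise_letter /= (negPf nya) /= => /andP[/eqP xa /eqP ya].
have [Cs Ry] := Rs a.
have lt_c : (nth 0%N C a < la i.+1)%N by apply/(istab_mem tabRC); exists (s a);
  rewrite -?ya.
have /(istab_mem tabRC)[b' Rb Cb] := leq_trans lt_c (la_anti i).
have [Cs' Ry'] := Rs (s^-1 b')%g; rewrite permKV in Cs' Ry'.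
exists a, (s^-1 b')%g; split=> //.
- by apply/eqP => eab; move: Ry'; rewrite -eab Rb ya => /eqP;
  rewrite (gtn_eqF (ltnSn i)).
- by rewrite Cs' Cb.
have := rel (s^-1 b')%g;
  rewrite /raise_letter /= Ry' Rb => /orP[/eqP <- //|/andP[/eqP]//].
Qed.

Lemma istab_cons la R C j : (0 < la j)%N -> istab (pred_at la j) R C ->
  istab la (j :: R) ((la j).-1 :: C).
Proof.
move=> laj [sC uRC RC]; split=> [||r c]; first by rewrite /= sC.
  by rewrite /= uRC andbT RC /pred_at eqxx; lia.
rewrite inE RC xpair_eqE /pred_at.
by case: (eqVneq r j) => [->|_] /=; [case: eqP; lia | rewrite subn0].
Qed.

Lemma anti_le la : (forall i, la i.+1 <= la i)%N ->
  forall i j, (i <= j)%N -> (la j <= la i)%N.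
Proof. by move=> anti i j /subnKC <-; elim: (j - i)%N => [|t IH];
  rewrite ?addn0 // addnS (leq_trans (anti _)). Qed.

(** The first entry occupies the removable cell at the end of row j. In the first row of the
    determinant only this entry can contribute, since no other cell of its column lies in row j or
    below. *)
Lemma slice_ptab la R C j a : (forall i, la i.+1 <= la i)%N ->
  (la j.+1 < la j)%N -> istab (pred_at la j) R C -> (j <= a)%N ->
  slice a (ptab (j :: R) ((la j).-1 :: C)) = if a == j then ptab R C else 0.
Proof.
move=> la_anti lt_j tabRC le_ja; apply/funext => x.
rewrite /slice /ptab /= eqSS; have [sx|nsx] := eqVneq (size x) (size R); last first.
  by case: ifP => // _; rewrite (negPf nsx).
rewrite (expand_det_row _ ord0) big_ord_recl big1 ?addr0 => [|b _]; last first.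
  rewrite mxE /= add0n; case: andP => [[/eqP cC /eqP aR]|]; last by rewrite mul0r.
  have : (((la j).-1 < pred_at la j a)%N) by apply/(istab_mem tabRC); exists b.
  rewrite /pred_at; case: (eqVneq a j) => [->|naj]; first by rewrite subn1 ltnn.
  rewrite subn0; have := @anti_le _ la_anti j.+1 a; lia.
rewrite mxE /= eqxx /= /cofactor addn0 expr0 mul1r.
case: (eqVneq a j) => _; last by rewrite mul0r.
rewrite mul1r sx eqxx; congr (\det _).
by apply/matrixP => b c; rewrite !mxE.
Qed.

Inductive tab_span la : wfun -> Prop :=
| tab_span0 : tab_span la 0
| tab_spanD a R C f : istab la R C -> tab_span la f ->
  tab_span la (a *: ptab R C + f).

Lemma tab_span_add la f g : tab_span la f -> tab_span la g -> tab_span la (f + g).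
Proof.
elim=> [|a R C f' tRC _ IH] gs; first by rewrite add0r.
by rewrite -addrA; apply: tab_spanD => //; exact: IH.
Qed.

Lemma count_istab la R C l : istab la R C -> count_mem l R = la l.
Proof.
move=> [sC uRC RC].
rewrite -[R](unzip1_zip (t := C)) ?sC // count_map -size_filter.
rewrite -[RHS](size_iota 0) -[RHS](size_map (pair l)).
apply: perm_size; apply: uniq_perm.
- by rewrite filter_uniq.
- by rewrite map_inj_uniq ?iota_uniq // => ? ? [].
move=> [r c]; rewrite mem_filter RC /=.
apply/andP/mapP => [[/eqP -> lt_c]|[c']]; first by exists c; rewrite ?mem_iota ?add0n.
by rewrite mem_iota add0n => lt_c [-> ->].
Qed.

Lemma weight_ptab la R C : istab la R C -> weight la (ptab R C).
Proof.
move=> tRC x /ptab_neq0[sx [s xs]] l; rewrite -(count_istab l tRC).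
have -> : x = permw s R.
  apply: (eq_words (d := size R)) => // [|a]; first exact: size_permw.
  by rewrite nth_permw; case: (xs a).
exact/seq.permP/perm_permw.
Qed.

Lemma tab_span_weight la f : tab_span la f -> weight la f.
Proof.
elim=> [x|a R C g tRC _ IH]; first by rewrite eqxx.
apply: weightD => // x nz; apply: (weight_ptab tRC); apply: contra_neq nz => z.
by rewrite -[LHS]/(a * ptab R C x) z mulr0.
Qed.

Lemma divpow_tab_span la f i m : GRing.lreg (2%:R : k) ->
  (forall i, la i.+1 <= la i)%N -> tab_span la f -> (0 < m)%N -> divpow i m f = 0.
Proof.
move=> reg2 la_anti; elim=> [|a R C g tRC _ IH] m0; first by rewrite raddf0.
by rewrite linearP /= (divpow_ptab _ reg2 la_anti tRC m0) scaler0 add0r IH.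
Qed.

Lemma tab_span_prepend la j g : (forall i, la i.+1 <= la i)%N -> (la j.+1 < la j)%N ->
  tab_span (pred_at la j) g ->
  exists2 q, tab_span la q & forall a, (j <= a)%N ->
    slice a q = if a == j then g else 0.
Proof.
move=> la_anti lt_j; elim=> [|b R C f tRC _ [q qs qj]].
  by exists 0 => [|a _]; [exact: tab_span0 | rewrite raddf0; case: ifP].
exists (b *: ptab (j :: R) ((la j).-1 :: C) + q) => [|a le_ja].
  by apply: tab_spanD => //; apply: istab_cons => //; lia.
by rewrite linearP /= (slice_ptab la_anti lt_j tRC le_ja) qj //; case: ifP;
  rewrite ?scaler0 ?addr0.
Qed.

(** Peeling as in [cocycle_lift]: the top slice of f - q is again killed by all divided powers. It
    vanishes by [divpow_inj] if la (j+1) = la j; otherwise it is a combination of smaller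
    polytabloids by induction, and [tab_span_prepend] extends these. *)
Lemma kernel_tab_span n d la f : GRing.lreg (2%:R : k) ->
  (forall i, la i.+1 <= la i)%N ->
  (forall i, (n <= i)%N -> la i = 0%N) -> \sum_(i < n) la i = d ->
  weight la f -> (forall i m, (0 < m)%N -> divpow i m f = 0) -> tab_span la f.
Proof.
move=> reg2.
elim/ltn_ind: d la f => d IH la f la_anti la0 sum_la wf f0.
suff [q qs fq] : exists2 q, tab_span la q & forall a, (0 <= a)%N ->
  slice a (f - q) = 0.
  have [z0|nz] := eqVneq ((f - q) [::]) 0.
    have -> : f = q; last exact: qs.
    by apply/eqP; rewrite -subr_eq0; apply/eqP/wfunP => // a; rewrite fq ?raddf0.
  (* A nonzero value at the empty word forces la = 0; the polytabloid of the empty tableau then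
     corrects this value. *)
  have la00 l : la l = 0%N.
    by rewrite -(weightB wf (tab_span_weight qs) nz).
  have -> : f = (f - q) [::] *: ptab [::] [::] + q.
    apply/eqP; rewrite -subr_eq; apply/eqP/wfunP => [|a].
      by rewrite -[RHS]/(_ * ptab [::] [::] [::]) /ptab /= det_mx00 mulr1.
    rewrite fq // linearZ /= (_ : slice a _ = 0) ?scaler0 //.
  by apply: tab_spanD qs; split=> // r c; rewrite la00.
suff /(_ n 0%N) : forall t j, (n - j)%N = t -> (j <= n)%N ->
    exists2 q, tab_span la q & forall a, (j <= a)%N -> slice a (f - q) = 0.
  by apply=> //; rewrite subn0.
elim=> [|t IHt] j nj le_jn.
  exists 0 => [|a le_ja]; first exact: tab_span0.
  by rewrite subr0 (weight_slice0 _ wf) // la0 //; lia.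
have lt_jn : (j < n)%N by lia.
have [|q qs fq] := IHt j.+1 _ lt_jn; first by lia.
have wv : weight la (f - q) := weightB wf (tab_span_weight qs).
have v0 i m : (0 < m)%N -> divpow i m (f - q) = 0.
  by move=> m0; rewrite raddfB /= f0 // (divpow_tab_span _ reg2 la_anti qs m0) subrr.
have [laj|laj] := posnP (la j).
  exists q => // a; rewrite leq_eqVlt => /orP[/eqP <-|/fq //].
  exact: weight_slice0 wv.
have wvj := weight_slice laj wv.
have vj i m : (0 < m)%N -> divpow i m (slice j (f - q)) = 0.
  by move=> m0; rewrite -slice_divpow_top ?v0 ?raddf0.
have := la_anti j; rewrite leq_eqVlt => /orP[/eqP eq_j|lt_j].
  exists q => // a; rewrite leq_eqVlt => /orP[/eqP <-|/fq //].
  apply: (divpow_inj (j := j) (s := 1)) => // [x /wvj cx|a' a'0]; last exact: vj.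
  by rewrite !cx /pred_at eqxx (gtn_eqF (ltnSn j)) eq_j; lia.
have span_j : tab_span (pred_at la j) (slice j (f - q)).
  apply: (IH (\sum_(i < n) pred_at la j i)%N) => //.
  - by rewrite -sum_la -(sum_pred_at lt_jn laj).
  - exact: pred_at_anti.
  - by move=> i /la0; rewrite /pred_at => ->.
have [q' q's q'j] := tab_span_prepend la_anti lt_j span_j.
exists (q + q') => [|a le_ja]; first exact: tab_span_add.
rewrite opprD addrA raddfB /= q'j //.
by case: (eqVneq a j) => [->|naj]; rewrite ?subrr // fq ?subr0 //; lia.
Qed.

End Polytabloids.

(** * Adding p^r to the first part *)

Lemma dvdn_bin_pfactor p r i : prime p -> (0 < i < p ^ r)%N -> (p %| 'C(p ^ r, i))%N.
Proof.
move=> p_pr; case: i => // i /= lt_i; apply: contraT => npC.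
have : (p ^ r %| i.+1 * 'C(p ^ r, i.+1))%N by rewrite -mul_bin_diag dvdn_mulr.
rewrite Gauss_dvdl; last by rewrite coprimeXl // prime_coprime.
by move/dvdn_leq => /(_ isT); rewrite leqNgt lt_i.
Qed.

(** In Vandermonde's sum the terms 0 < i < p^r are divisible by p, and the term i = 0 is C(e, p^r) =
    0. *)
Lemma bin_pfactorD (k : nzRingType) p r e : p \in [pchar k] -> (e < p ^ r)%N ->
  ('C(p ^ r + e, p ^ r))%:R = 1 :> k.
Proof.
move=> charp lt_e; have p_pr := pcharf_prime charp.
rewrite -binomial.Vandermonde big_ord_recr /= binn subnn bin0 mul1n natrD natr_sum
  big1 ?add0r // => -[i lt_i] _ /=.
apply/eqP; rewrite -(dvdn_pcharf charp).
case: i lt_i => [|i] lt_i; first by rewrite subn0 (bin_small lt_e) muln0.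
by rewrite dvdn_mulr // dvdn_bin_pfactor.
Qed.

Section Shuffle.

Variable k : comNzRingType.
Notation wfun := (seq nat -> k^o).
Implicit Types (f g u : wfun) (x y : seq nat) (la : nat -> nat).

Fixpoint deletions q x : seq (seq nat) :=
  if x is c :: x' then
    map (cons c) (deletions q x') ++
    (if (c == 0%N) && (0 < q)%N then deletions q.-1 x' else [::])
  else if q == 0%N then [:: [::]] else [::].

(* Multiplication by the invariant element e_0^(q) of the divided power       *)
(* algebra; it adds q to the first part of the weight.                        *)
Definition mulz q f : wfun := fun x => \sum_(y <- deletions q x) f y.

Fact mulz_linear q : linear (mulz q).
Proof. by move=> a f g; apply/funext => x;
  rewrite [LHS]big_split /= -scaler_sumr. Qed.
HB.instance Definition _ q := GRing.isLinear.Build k wfun wfun _ (mulz q)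
  (mulz_linear q).

Lemma mulz_nil q f : mulz q f [::] = f [::] *+ (q == 0%N).
Proof. by rewrite /mulz /=; case: ifP; rewrite ?big_nil ?big_seq1. Qed.

Lemma slice_mulz q f c :
  slice c (mulz q f) = mulz q (slice c f) + mulz q.-1 f *+ ((c == 0%N) && (0 < q)%N).
Proof.
apply/funext=> x; rewrite /slice /mulz /= big_cat big_map /= mulrb.
by case: ifP => _; rewrite ?big_nil.
Qed.

(** Both sides choose q zeros to delete and, among the other letters, m letters i to raise; raising
    never creates a zero. *)
Lemma divpow_mulz i m q f : divpow i m (mulz q f) = mulz q (divpow i m f).
Proof.
apply/funext => x; elim: x m q f => [|c x IH] m q f.
  by rewrite divpow_nil !mulz_nil divpow_nil mulrnAC.
rewrite -[LHS]/(slice c _ x) -[RHS]/(slice c _ x) slice_divpow !slice_mulz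
  slice_divpow.
rewrite /= mulr0n addr0 !raddfD !raddfMn /=.
rewrite -[LHS]/(_ x + (_ *+ _) x + (_ *+ _) x) -[RHS]/(_ x + (_ *+ _) x + (_ *+ _) x).
by rewrite !natmulfctE !IH addrAC.
Qed.

Lemma deletions_count q x y : y \in deletions q x ->
  forall l : nat, count_mem l x = (count_mem l y + q * (l == 0%N))%N.
Proof.
elim: x q y => [|c x IH] q y /=; first by case: eqP => // -> /[!inE] /eqP ->.
rewrite mem_cat => /orP[/mapP[z zx ->] l|]; first by rewrite (IH _ _ zx) /= addnA.
case: ifP => // /andP[/eqP -> q0] /IH yx l; rewrite yx eq_sym.
by case: q q0 {yx} => // q _; rewrite mulSn addnCA.
Qed.

Lemma deletions_size q x y : y \in deletions q x -> size x = (size y + q)%N.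
Proof.
elim: x q y => [|c x IH] q y /=; first by case: eqP => // -> /[!inE] /eqP ->.
rewrite mem_cat => /orP[/mapP[z /IH -> ->]//|].
by case: ifP => // /andP[_ q0] /IH ->; rewrite -addnS prednK.
Qed.

Lemma mulz_neq0 q f x : mulz q f x != 0 -> exists2 y, y \in deletions q x & f y != 0.
Proof.
rewrite /mulz big_seq => nz; apply/hasP; apply: contra_neqT nz => /hasPn f0.
by rewrite big1 // => y /f0; rewrite negbK => /eqP.
Qed.

Lemma mulz_small q f x : (count_mem 0%N x < q)%N -> mulz q f x = 0.
Proof.
move=> lt_x; rewrite /mulz big_seq big1 // => y /deletions_count/(_ 0%N).
by rewrite eqxx muln1 => cx; move: lt_x; rewrite cx; lia.
Qed.

Definition symw f := forall x y, perm_eq x y -> f x = f y.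

(** Whichever q zeros of x are deleted, a rearrangement of y remains. *)
Lemma mulz_sym q f x y :
  symw f -> perm_eq x (nseq q 0%N ++ y) -> mulz q f x = f y *+ 'C(count_mem 0%N x, q).
Proof.
elim: x q f y => [|c x IH] q f y fs xy.
  have := perm_size xy; rewrite size_cat size_nseq /= => sz.
  have -> : q = 0%N by lia.
  have -> : y = [::] by apply: size0nil; lia.
  exact: mulz_nil.
have slice_sym a : symw (slice a f) by move=> z z' zz'; rewrite /slice; apply: fs;
  rewrite perm_cons.
rewrite -[LHS]/(slice c _ x) slice_mulz.
have [c0|nc0] /= := eqVneq c 0%N; last first.
  rewrite mulr0n addr0.
  have cy : c \in y.
    by have := perm_mem xy c;
      rewrite mem_head mem_cat mem_nseq (negPf nc0) andbF /= => <-.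
  have yy := perm_to_rem cy.
  rewrite (IH _ _ (rem c y)) //; last first.
    rewrite -(perm_cons c) (permPl xy) -cat1s perm_sym.
    by rewrite perm_catCA perm_cat2l perm_sym.
  by rewrite (fs _ _ yy) /= (negPf nc0).
rewrite {c}c0 in xy *.
have cy : (1 + count_mem 0%N x)%N = (q + count_mem 0%N y)%N.
  by have := seq.permP xy (pred1 0%N); rewrite /= count_cat count_nseq mul1n.
have term1 : mulz q (slice 0%N f) x = f y *+ 'C(count_mem 0%N x, q).
  have [lt_x|le_x] := ltnP (count_mem 0%N x) q.
    by rewrite mulz_small // bin_small.
  have y0 : 0%N \in y by rewrite -has_pred1 has_count; lia.
  have yy := perm_to_rem y0.
  rewrite (IH _ _ (rem 0%N y)) //; first by rewrite /slice (fs _ _ yy).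
  rewrite -(perm_cons 0%N) (permPl xy) -cat1s perm_sym.
  by rewrite perm_catCA perm_cat2l perm_sym.
rewrite -[LHS]/(_ x + (_ *+ _) x) natmulfctE term1;
  case: q xy cy {term1} => [|q] xy cy /=; first by rewrite !bin0 addr0.
rewrite mulr1n (IH _ _ y) //; first by rewrite -mulrnDr add1n binS.
by rewrite -(perm_cons 0%N).
Qed.

Lemma zeros_split q x : (q <= count_mem 0%N x)%N ->
  exists z, perm_eq x (nseq q 0%N ++ z).
Proof.
move=> le_x; exists (nseq (count_mem 0%N x - q) 0%N ++ filter (predC1 0%N) x).
rewrite catA -nseqD subnKC //.
have /all_pred1P := filter_all (pred1 0%N) x; rewrite size_filter => <-.
by rewrite perm_sym; exact: permEl (perm_filterC _ _).
Qed.

Lemma symw_mulz q f : symw f -> symw (mulz q f).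
Proof.
move=> fs x y xy; have cxy := seq.permP xy (pred1 0%N).
have [lt_x|le_x] := ltnP (count_mem 0%N x) q.
  by rewrite !mulz_small // -cxy.
have [z xz] := zeros_split le_x.
have yz : perm_eq y (nseq q 0%N ++ z) by rewrite -(permPl xy).
by rewrite (mulz_sym fs xz) (mulz_sym fs yz) cxy.
Qed.

Lemma symw_divpow i m f : symw f -> symw (divpow i m f).
Proof.
move=> fs x y xy; have [s ->] := perm_eq_permw (erefl _) xy.
rewrite -divpow_permw //; apply: eq_recolor => z;
  rewrite mem_raises => /andP[/eqP sz _].
by apply: fs; rewrite perm_sym perm_permw.
Qed.

Definition of_size d f := forall x, f x != 0 -> size x = d.

Lemma of_size_divpow d i m f : of_size d f -> of_size d (divpow i m f).
Proof.
by move=> fd x /recolor_neq0[y]; rewrite mem_raises => /andP[/eqP <- _] /fd.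
Qed.

Definition sym_of_size d f := symw f /\ of_size d f.

Lemma sym_of_sizeD d f g : sym_of_size d f -> sym_of_size d g ->
  sym_of_size d (f + g).
Proof.
move=> [fs fd] [gs gd]; split=> [x y xy|x nz].
  by rewrite -[LHS]/(f x + g x) (fs _ _ xy) (gs _ _ xy).
have [z|/fd //] := eqVneq (f x) 0.
by apply: gd; apply: contra_neq nz => z'; rewrite -[LHS]/(f x + g x) z z' addr0.
Qed.

Lemma sym_of_sizeZ d a f : sym_of_size d f -> sym_of_size d (a *: f).
Proof.
move=> [fs fd]; split=> [x y xy|x nz]; first by rewrite -[LHS]/(a * f x) (fs _ _ xy).
by apply: fd; apply: contra_neq nz => z; rewrite -[LHS]/(a * f x) z mulr0.
Qed.

Lemma sym_of_size0 d : sym_of_size d 0.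
Proof. by split=> // x; rewrite eqxx. Qed.

Lemma sym_of_size_divpow d i m f : sym_of_size d f -> sym_of_size d (divpow i m f).
Proof. by move=> [fs fd]; split; [exact: symw_divpow | exact: of_size_divpow]. Qed.

Definition raise0 la q : nat -> nat := fun l => (la l + q * (l == 0%N))%N.

Lemma count_zeros q x (l : nat) :
  count_mem l (nseq q 0%N ++ x) = (count_mem l x + q * (l == 0%N))%N.
Proof. by rewrite count_cat count_nseq /= eq_sym addnC mulnC. Qed.

Lemma weight_mulz la q f : weight la f -> weight (raise0 la q) (mulz q f).
Proof.
by move=> wf x /mulz_neq0[y yx fy] l; rewrite (deletions_count yx) (wf _ fy).
Qed.

Definition total la : wfun := fun x => `[< forall l : nat, count_mem l x = la l >]%:R.

Lemma total_weight la : weight la (total la).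
Proof. by move=> x; rewrite /total; case: asboolP => //; rewrite eqxx. Qed.

Lemma symw_total la : symw (total la).
Proof.
move=> x y xy; congr (nat_of_bool _)%:R; apply: asbool_equiv_eq.
by split=> xl l; rewrite -xl (seq.permP xy).
Qed.

(** * Transfer between degrees d and d + p^r *)

Section Transfer.

Variables (p r d : nat).
Hypothesis charp : p \in [pchar k].
Let q := (p ^ r)%N.
Hypothesis lt_dq : (d < q)%N.

(** Prepending q zeros to the argument undoes [mulz q]: the binomial coefficient from [mulz_sym] is
    1 in k, as x has fewer than q zeros. *)
Lemma mulz_cat f x : symw f -> (size x < q)%N -> mulz q f (nseq q 0%N ++ x) = f x.
Proof.
move=> fs lt_x; rewrite (mulz_sym fs (perm_refl _)) count_cat count_nseq mul1n.
by rewrite -mulr_natr bin_pfactorD ?mulr1 // (leq_ltn_trans (count_size _ _)).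
Qed.

Lemma mulz_inj f : sym_of_size d f -> mulz q f = 0 -> f = 0.
Proof.
move=> [fs fd] f0; apply/funext => x; apply/eqP/negPn/negP => nz.
have sx := fd x nz; move/negP: nz; apply.
by rewrite -mulz_cat ?sx // f0.
Qed.

Lemma symw_eq f g : symw f -> symw g ->
  (forall x, (f x != 0) || (g x != 0) ->
    size x = (d + q)%N /\ (q <= count_mem 0%N x)%N) ->
  (forall x, size x = d -> f (nseq q 0%N ++ x) = g (nseq q 0%N ++ x)) -> f = g.
Proof.
move=> fs gs fg eq_fg; apply/funext => x.
have [/fg[sx cx]|] := boolP ((f x != 0) || (g x != 0)); last first.
  by rewrite negb_or !negbK => /andP[/eqP -> /eqP ->].
have [z xz] := zeros_split cx.
rewrite (fs _ _ xz) (gs _ _ xz) eq_fg //.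
by have := perm_size xz; rewrite sx size_cat size_nseq addnC => /addnI.
Qed.

Lemma mulz_total la : (forall x, (forall l :
  nat, count_mem l x = la l) -> size x = d) ->
  mulz q (total la) = total (raise0 la q).
Proof.
move=> la_d; have total_d : of_size d (total la).
  by move=> x; rewrite /total; case: asboolP => [/la_d|]; rewrite ?eqxx.
apply: symw_eq.
- exact/symw_mulz/symw_total.
- exact: symw_total.
- move=> x.
  have wx : (mulz q (total la) x != 0) || (total (raise0 la q) x != 0) ->
      forall l : nat, count_mem l x = raise0 la q l.
    by case/orP; [exact: (weight_mulz (@total_weight la)) | exact: total_weight].
  move=> /wx xl.
  have le_x : (q <= count_mem 0%N x)%N by rewrite xl /raise0 eqxx muln1 leq_addl.
  split=> //; have [z xz] := zeros_split le_x.
  rewrite (perm_size xz) size_cat size_nseq addnC; congr (_ + _)%N; apply: la_d => l.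
  have := xl l; rewrite (seq.permP xz) count_zeros /raise0 => /eqP.
  by rewrite eqn_add2r => /eqP.
move=> x sx; rewrite mulz_cat ?sx //; last exact: symw_total.
congr (nat_of_bool _)%:R; apply: asbool_equiv_eq.
by split=> xl l; have := xl l; rewrite /raise0 count_zeros; [move-> | move/eqP;
  rewrite eqn_add2r => /eqP].
Qed.

(** Words in the support of [divpow i m u'] have at least q zeros, so by symmetry these functions
    are [mulz q] of their restrictions w to words beginning with q zeros. Injectivity of [mulz]
    pulls the cocycle relations back to w, and [cocycle_lift] provides u. *)
Lemma transfer_back n la u' : (forall i, la i.+1 <= la i)%N ->
  (forall i, (n <= i)%N -> la i = 0%N) ->
  weight (raise0 la q) u' -> of_size (d + q) u' ->
  (forall i m, (0 < m)%N -> symw (divpow i m u')) ->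
  exists2 u, weight la u & forall i m, (0 < m)%N ->
    symw (divpow i m u) /\ divpow i m u' = mulz q (divpow i m u).
Proof.
move=> la_anti la0 wu' su' symu'.
pose w i m : wfun := fun x => divpow i m u' (nseq q 0%N ++ x).
have w1 i m : (0 < m)%N -> weight_shift la i m (w i m).
  move=> m0 x /(divpow_weight wu') wx l; have := wx l.
  by rewrite /raise0 count_zeros; lia.
have wsym i m : (0 < m)%N -> sym_of_size d (w i m).
  move=> m0; split=> [x y xy|x /(of_size_divpow su')].
    by apply: symu'; rewrite // perm_cat2l.
  by rewrite size_cat size_nseq addnC => /eqP; rewrite eqn_add2r => /eqP.
have mulzw i m : (0 < m)%N -> mulz q (w i m) = divpow i m u'.
  move=> m0; apply: symw_eq.
  - by apply: symw_mulz; case: (wsym i m m0).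
  - exact: symu'.
  - move=> x /orP[/mulz_neq0[y yx wy]|nz]; split.
    + by rewrite (deletions_size yx); have [_ ->] := wsym i m m0.
    + by rewrite (deletions_count yx) eqxx muln1 leq_addl.
    + exact: of_size_divpow su' _ nz.
    have := divpow_weight wu' nz 0%N; rewrite /raise0 eqxx muln0 addn0 muln1 => ->.
    by rewrite addnAC leq_addl.
  by move=> x sx; rewrite mulz_cat ?sx //; case: (wsym i m m0).
have cw : cocycle la w.
  have [_ c2 c3] := cocycle_divpow wu'; split=> // [i a m m0|i j m a nij m0 lt_a].
    apply/eqP; rewrite -subr_eq0; apply/eqP; apply: mulz_inj.
      rewrite -scaleN1r -scaler_nat.
      apply: sym_of_sizeD; first exact/sym_of_size_divpow/wsym.
      by do 2!apply: sym_of_sizeZ; apply: wsym; lia.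
    rewrite raddfB raddfMn /= -divpow_mulz !mulzw //; last by lia.
    by rewrite c2 // subrr.
  apply: mulz_inj.
    apply: sym_of_sizeD; first exact/sym_of_size_divpow/wsym.
    apply: big_ind => [|f g|b _]; [exact: sym_of_size0 | exact: sym_of_sizeD |].
    by apply: sym_of_sizeZ; do 2!apply: sym_of_size_divpow; exact: wsym.
  rewrite raddfD raddf_sum /= -divpow_mulz mulzw // -[RHS](c3 i j m a nij m0 lt_a).
  congr (_ + _); apply: eq_bigr => b _.
  by rewrite linearZ /= -!divpow_mulz mulzw.
have [u wu uw] := cocycle_lift la_anti la0 (erefl _) cw.
by exists u => // i m m0; rewrite uw // mulzw //; have [] := wsym i m m0.
Qed.

End Transfer.

End Shuffle.

Lemma content_size n (la : nat -> nat) (x : seq nat) :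
  (forall i, (n <= i)%N -> la i = 0%N) -> (forall l : nat, count_mem l x = la l) ->
  size x = (\sum_(i < n) la i)%N.
Proof.
move=> la0 xl; rewrite (eq_bigr (fun i : 'I_n => count_mem (i : nat) x)) => [|i _];
  last by rewrite xl.
have: all (fun c => (c < n)%N) x.
  apply/allP => c; rewrite -has_pred1 has_count xl ltnNge => lc.
  by rewrite ltnNge; apply: contra lc => /la0 ->.
elim: x {xl} => [|c x IH] /=; first by rewrite big1.
case/andP=> lt_c /IH ->; rewrite big_split /=.
suff -> : (\sum_(i < n) (c == i :> nat) = 1)%N by [].
rewrite (bigD1 (Ordinal lt_c)) //= eqxx big1 // => i.
by rewrite eq_sym -val_eqE /= => /negPf ->.
Qed.

(** * The permutation module as a space of functions on words *)

Section TabloidWords.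

Variables (k : fieldType) (d : nat) (mu : seq nat).
Hypothesis mu_part : is_partition d mu.

Notation wfun := (seq nat -> k^o).
Notation tabl := (tabloid d mu).
Let la l := nth 0%N mu l.
Implicit Types (T : tabl) (x y : seq nat).

Lemma part_anti i : (la i.+1 <= la i)%N.
Proof.
have /and3P[mu_sorted _ _] := mu_part.
have [lt_i|le_i] := ltnP i.+1 (size mu); last by rewrite /la (nth_default _ le_i).
by apply: (sortedP 0%N mu_sorted).
Qed.

Lemma part_out i : (size mu <= i)%N -> la i = 0%N.
Proof. exact: nth_default. Qed.

Lemma part_sum : (\sum_(i < size mu) la i)%N = d.
Proof. by have /and3P[_ _ /eqP <-] := mu_part;
  rewrite sumnE (big_nth 0%N) big_mkord. Qed.

Lemma content_sized x : (forall l : nat, count_mem l x = la l) -> size x = d.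
Proof. by move=> xl; rewrite -part_sum; apply: content_size xl => i;
  exact: part_out. Qed.

Definition wd T : seq nat := [seq (val T a : nat) | a <- enum 'I_d].

Lemma size_wd T : size (wd T) = d.
Proof. by rewrite size_map size_enum_ord. Qed.

Lemma nth_wd T (a : 'I_d) : nth 0%N (wd T) a = val T a.
Proof. by rewrite (nth_map a) ?size_enum_ord // nth_ord_enum. Qed.

Lemma wd_inj : injective wd.
Proof.
move=> T T' eq_w; apply/val_inj/ffunP => a; apply/val_inj => /=.
by have := nth_wd T' a; rewrite -eq_w nth_wd.
Qed.

Lemma wd_count T (l : nat) : count_mem l (wd T) = la l.
Proof.
rewrite count_map -sum1_count big_enum_cond /=.
transitivity #|[set a | (val T a : nat) == l]|; first by rewrite -sum1dep_card.
have [lt_l|le_l] := ltnP l (size mu); last first.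
  rewrite part_out //; apply/eqP; rewrite cards_eq0; apply/eqP/setP => a;
    rewrite !inE.
  by apply/negbTE; rewrite neq_ltn (leq_trans (ltn_ord _)).
by have /forallP/(_ (Ordinal lt_l))/eqP := valP T.
Qed.

Lemma wd_surj x : (forall l : nat, count_mem l x = la l) -> exists T, wd T = x.
Proof.
move=> xl; have sx := content_sized xl.
have lt_x (a : 'I_d) : (nth 0%N x a < size mu)%N.
  rewrite ltnNge; apply/negP => /part_out; rewrite -xl; apply/eqP.
  by rewrite -lt0n -has_count has_pred1 mem_nth // sx.
pose f := [ffun a : 'I_d => Ordinal (lt_x a)].
have f_tab : is_tabloid f.
  apply/forallP => i; apply/eqP; rewrite -/(la i) -xl.
  rewrite -[x in RHS](mkseq_nth 0%N) /mkseq sx -val_enum_ord -map_comp count_map.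
  rewrite -sum1_count big_enum_cond -sum1dep_card; apply: eq_bigl => a.
  by rewrite /= ffunE -val_eqE.
exists (Sub f f_tab); apply: eq_words => [||a]; rewrite ?size_wd ?sx //.
by rewrite nth_wd SubK ffunE.
Qed.

Lemma wd_act T s : wd (tabloid_act T s) = permw s^-1 (wd T).
Proof.
apply: (eq_words (d := d)) => [||a]; rewrite ?size_wd ?size_permw //.
by rewrite nth_permw !nth_wd /= ffunE.
Qed.

(** Coordinates of a vector of M^mu, extended by 0 to all words. By [vf_inj], [vf_weight] and
    [vf_surj] this identifies M^mu with the functions of weight la. *)
Definition vf (v : 'rV[k]_#|{: tabl}|) : wfun :=
  fun x => \sum_(T : tabl) v 0 (enum_rank T) *+ (wd T == x).

Fact vf_linear : linear vf.
Proof.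
move=> a v v'; apply/funext => x;
  rewrite -[RHS]/(a * vf v x + vf v' x) /vf mulr_sumr -big_split.
by apply: eq_bigr => T _; rewrite /= !mxE mulrnDl mulrnAr.
Qed.
HB.instance Definition _ := GRing.isLinear.Build k _ wfun _ vf vf_linear.

Lemma vf_wd v T : vf v (wd T) = v 0 (enum_rank T).
Proof.
rewrite /vf (bigD1 T) //= eqxx big1 ?addr0 // => T' nT.
by rewrite (inj_eq wd_inj) (negPf nT).
Qed.

Lemma vf_weight v : weight la (vf v).
Proof.
move=> x nz l; suff [T <-] : exists T, wd T = x by exact: wd_count.
apply: contrapT => noT; move/negP: nz; apply; apply/eqP.
by apply: big1 => T _; case: eqP => // eT; case: noT; exists T.
Qed.

Lemma vf_inj v v' : vf v = vf v' -> v = v'.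
Proof.
move=> eq_v; apply/rowP => i; rewrite -(enum_valK i) -!vf_wd.
by rewrite eq_v.
Qed.

Lemma vf_surj f : weight la f -> exists v, vf v = f.
Proof.
move=> wf; exists (\row_i f (wd (enum_val i))); apply/funext => x.
have [[T <-]|noT] := pselect (exists T, wd T = x);
  first by rewrite vf_wd mxE enum_rankK.
rewrite /vf big1 => [|T _]; last by case: eqP => // eT; case: noT; exists T.
by apply/esym/eqP/negPn/negP => /wf/wd_surj.
Qed.

Lemma vf_tabloid_vec T x : vf (tabloid_vec k T) x = (wd T == x)%:R.
Proof.
rewrite /vf (bigD1 T) //= /tabloid_vec mxE !eqxx big1 ?addr0 // => T' nT.
by rewrite mxE eqxx (inj_eq enum_rank_inj) (negPf nT) mul0rn.
Qed.

Lemma vf_young v s x : size x = d -> vf (v *m young_mx k mu s) x = vf v (permw s x).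
Proof.
move=> sx; rewrite [in LHS](row_sum_delta v) [in RHS](row_sum_delta v).
rewrite mulmx_suml !raddf_sum !fct_sumE; apply: eq_bigr => i _.
rewrite -scalemxAl /= !linearZ /= -(enum_valK i) -/(tabloid_vec k (enum_val i)).
rewrite tabloid_vecM -[LHS]/(_ * vf _ x) -[RHS]/(_ * vf _ _) !vf_tabloid_vec wd_act.
congr (_ * _%:R); congr nat_of_bool; apply/eqP/eqP => [<-|->].
  by rewrite permwM mulgV permw1 ?size_wd.
by rewrite permwM mulVg permw1.
Qed.

Notation diag := (diagram mu).

Lemma cellP (r c : nat) : (c < la r)%N ->
  exists e : diag, (cell_row e : nat) = r /\ cell_col e = c.
Proof.
move=> lt_c; have lt_r : (r < size mu)%N.
  by rewrite ltnNge; apply: contraL lt_c => /part_out ->.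
by exists (Tagged (fun i : 'I_(size mu) => 'I_(nth 0%N mu i)) (Ordinal lt_c :
  'I_(nth 0%N mu (Ordinal lt_r)))).
Qed.

Lemma cell_inj (e e' : diag) :
  (cell_row e : nat) = cell_row e' -> cell_col e = cell_col e' -> e = e'.
Proof.
case: e e' => [r c] [r' c']; rewrite /cell_row /cell_col /= => /val_inj er.
by case: r' / er c' => c' /val_inj ->.
Qed.

Lemma cell_lt (e : diag) : (cell_col e < la (cell_row e))%N.
Proof. by case: e => r c /=; exact: ltn_ord. Qed.

Definition tab_rows (t : tableau d mu) : seq nat :=
  [seq (cell_row (val t a) : nat) | a <- enum 'I_d].
Definition tab_cols (t : tableau d mu) : seq nat :=
  [seq cell_col (val t a) | a <- enum 'I_d].

Lemma zip_tab t : zip (tab_rows t) (tab_cols t) =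
  [seq ((cell_row (val t a) : nat), cell_col (val t a)) | a <- enum 'I_d].
Proof. by rewrite zip_map. Qed.

Lemma istab_tab t : istab la (tab_rows t) (tab_cols t).
Proof.
have [/injectiveP t_inj /forallP t_surj] := andP (valP t).
split=> [||r c]; first by rewrite !size_map.
  rewrite zip_tab map_inj_uniq ?enum_uniq // => a b [ra ca].
  exact/t_inj/cell_inj.
rewrite zip_tab; apply/mapP/idP => [[a _ [-> ->]]|]; first exact: cell_lt.
case/cellP=> e [<- <-]; have /codomP[a ->] := t_surj e.
by exists a; rewrite ?mem_enum.
Qed.

Lemma ptab_det (R C x : seq nat) : size R = d -> size x = d ->
  ptab k R C x = \det (\matrix_(a < d, b < d)
    ((nth 0%N C a == nth 0%N C b) && (nth 0%N x a == nth 0%N R b))%:R : 'M[k]_d).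
Proof. by move=> <- sx; rewrite /ptab sx eqxx. Qed.

Lemma prod_bool (I : finType) (P : pred I) :
  \prod_a (P a)%:R = [forall a, P a]%:R :> k.
Proof.
have [/forallP allP|] := boolP [forall a, P a].
  by rewrite big1 // => a _; rewrite allP.
by rewrite negb_forall => /existsP[a nPa]; rewrite (bigD1 a) //= (negPf nPa) mul0r.
Qed.

Lemma vf_polytabloid t : vf (polytabloid k t) = ptab k (tab_rows t) (tab_cols t).
Proof.
have sR : size (tab_rows t) = d by rewrite size_map size_enum_ord.
have nR (a : 'I_d) : nth 0%N (tab_rows t) a = cell_row (val t a).
  by rewrite (nth_map a) ?size_enum_ord // nth_ord_enum.
have nC (a : 'I_d) : nth 0%N (tab_cols t) a = cell_col (val t a).
  by rewrite (nth_map a) ?size_enum_ord // nth_ord_enum.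
apply/funext => x; have [sx|nsx] := eqVneq (size x) d; last first.
  rewrite /ptab ifN ?sR //; apply: contra_neqP nsx => /eqP/vf_weight.
  exact: content_sized.
rewrite ptab_det // /polytabloid raddf_sum fct_sumE.
(* Tabloids are moved by the inverse permutation, so s matches the Leibniz term of s^-1. *)
rewrite [RHS](reindex_inj invg_inj) /= big_mkcond; apply: eq_bigr => s _.
rewrite odd_permV.
under eq_bigr => a _ do rewrite mxE !nC nR.
rewrite prod_bool.
have -> : [forall a, (cell_col (val t a) == cell_col (val t (s^-1 a)%g)) &&
    (nth 0%N x a == cell_row (val t (s^-1 a)%g))] =
  (s \in col_stab t) && (wd (tabloid_act (tabloid_of t) s) == x).
  rewrite wd_act inE; apply/forallP/andP => [cx|[/forallP cs /eqP <-] a].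
    split; first by apply/forallP => a; have /andP[] := cx (s a); rewrite permK.
    apply/eqP/(eq_words (d := d)) => [||a];
      rewrite ?size_permw // nth_permw nth_wd ffunE.
    by have /andP[_ /eqP] := cx a.
  rewrite nth_permw nth_wd ffunE eqxx andbT.
  by have := cs (s^-1 a)%g; rewrite permKV.
case: (s \in col_stab t); last by rewrite mulr0.
by rewrite linearZ -[LHS]/(_ * vf _ _) vf_tabloid_vec.
Qed.

Lemma tab_of_istab R C : istab la R C ->
  exists t, tab_rows t = R /\ tab_cols t = C.
Proof.
move=> tabRC; have sR : size R = d by apply: content_sized => l;
  exact: count_istab tabRC.
have [sC uRC RC] := tabRC; rewrite sR in sC.
have lt_c (a : 'I_d) : (nth 0%N C a < la (nth 0%N R a))%N.
  by rewrite -RC -nth_zip ?sC ?sR // mem_nth // size_zip sC sR minnn.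
pose cell a := projT1 (cid (cellP (lt_c a))).
have cellE a : (cell_row (cell a) :
  nat) = nth 0%N R a /\ cell_col (cell a) = nth 0%N C a.
  exact: (projT2 (cid (cellP (lt_c a)))).
have t_tab : is_tableau [ffun a => cell a].
  apply/andP; split.
    apply/injectiveP => a b; rewrite !ffunE => eq_cell; apply/val_inj/eqP.
    rewrite -(nth_uniq (0, 0)%N _ _ uRC) ?size_zip ?sC ?sR ?minnn //=.
    rewrite !nth_zip ?sC ?sR //; have [<- <-] := cellE a; have [<- <-] := cellE b.
    by rewrite eq_cell.
  apply/forallP => e; have : ((cell_row e : nat), cell_col e) \in zip R C.
    by rewrite RC cell_lt.
  case/(nthP (0, 0)%N) => a; rewrite size_zip sC sR minnn => lt_a.
  rewrite nth_zip ?sC ?sR // => -[ra ca]; apply/codomP; exists (Ordinal lt_a).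
  have [rE cE] := cellE (Ordinal lt_a).
  by rewrite ffunE; apply: cell_inj; rewrite ?rE ?cE.
exists (Sub _ t_tab); split; (apply: (eq_words (d := d)) => // [|a];
  first by rewrite size_map size_enum_ord);
  by rewrite (nth_map a) ?size_enum_ord // nth_ord_enum SubK ffunE;
    have [] := cellE a.
Qed.

Hypothesis two_neq0 : (2%:R : k) != 0.

Let reg2 : GRing.lreg (2%:R : k) := mulfI two_neq0.

Lemma specht_kernel (v : 'rV[k]_#|{: tabl}|) :
  reflect (forall i m, (0 < m)%N -> divpow i m (vf v) = 0) (v <= specht_mx k d mu)%MS.
Proof.
apply: (iffP idP) => [/sub_sumsmxP[u ->] i m m0|kv].
  rewrite !raddf_sum big1 //= => t _.
  have : (u t *m <<polytabloid k t>>%MS <= polytabloid k t)%MS.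
    by rewrite -(genmxE (polytabloid k t)) submxMl.
  case/sub_rVP=> a ->; rewrite !linearZ /= vf_polytabloid.
  by rewrite (divpow_ptab i reg2 part_anti (istab_tab t) m0) scaler0.
have := kernel_tab_span reg2 part_anti part_out part_sum (@vf_weight v) kv.
suff span f : tab_span la f -> exists2 v', vf v' = f & (v' <= specht_mx k d mu)%MS.
  by case/span=> v' /vf_inj <-.
elim=> [|a R C g tabRC _ [v' <- v'S]]; first by exists 0; rewrite ?raddf0 ?sub0mx.
have [t [<- <-]] := tab_of_istab tabRC.
exists (a *: polytabloid k t + v'); first by rewrite linearP /= vf_polytabloid.
apply: addmx_sub v'S; apply: scalemx_sub.
by apply: (sumsmx_sup t) => //; rewrite genmxE.
Qed.

End TabloidWords.

(** * First cohomology *)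

Section PermutationCocycle.

Variables (k : comNzRingType) (d : nat) (la : nat -> nat).
Notation wfun := (seq nat -> k^o).
Hypothesis reg2 : GRing.lreg (2%:R : k).
Hypothesis la_d : forall x : seq nat, (forall l :
  nat, count_mem l x = la l) -> size x = d.

Variable Z : 'S_d -> wfun.
Hypothesis Z_weight : forall s, weight la (Z s).
Hypothesis ZM : forall (b s : 'S_d) x, size x = d ->
  Z (b * s)%g x = Z b (permw s x) + Z s x.

Lemma cocycle1 x : size x = d -> Z 1%g x = 0.
Proof.
move=> sx; have := ZM 1 1 sx; rewrite mulg1 permw1 // => Z1.
by apply: (addrI (Z 1%g x)); rewrite addr0 -Z1.
Qed.

(* A homomorphism from a Young subgroup to k is trivial on transpositions,    *)
(* hence trivial, when 2 is not zero in k.                                    *)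
Lemma cocycle_stab s x : size x = d -> permw s x = x -> Z s x = 0.
Proof.
move=> sx; have [n] := ubnP #|[set a | s a != a]|.
elim: n s => // n IH s lt_n sxx.
have [[a nsa]|fix_s] := pselect (exists a, s a != a); last first.
  have -> : s = 1%g; last exact: cocycle1.
  apply/permP => a; rewrite perm1; apply/eqP/negPn/negP => nsa.
  by apply: fix_s; exists a.
pose t := tperm a (s a).
have xsa (c : 'I_d) : nth 0%N x (s c) = nth 0%N x c by rewrite -{2}sxx nth_permw.
have tx : permw t x = x.
  apply: eq_words => [||c]; rewrite ?size_permw // nth_permw /t.
  by case: tpermP => [->|->|]; rewrite ?xsa.
have Zt : Z t x = 0.
  apply: reg2; rewrite mulr0 mulr_natl mulr2n -{1}tx -ZM //.
  by rewrite tperm2 cocycle1.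
(* The product s * t fixes a and every point fixed by s, so induction applies to it. *)
have -> : s = (s * t * t)%g by rewrite -mulgA tperm2 mulg1.
rewrite ZM // tx Zt addr0; apply: IH; last by rewrite -permwM tx sxx.
rewrite ltnS in lt_n; apply: leq_trans lt_n; apply: proper_card; apply/properP; split.
  apply/subsetP => c; rewrite !inE permM; apply: contra => /eqP scc.
  rewrite scc /t tpermD //; apply: contra nsa => /eqP eqc; first by rewrite eqc scc.
  by rewrite -(inj_eq (@perm_inj _ s)) eqc scc.
by exists a; rewrite !inE ?nsa // permM /t tpermR eqxx.
Qed.

(* H^1(S_d, M^la) = 0. *)
Lemma cocycle_coboundary : exists2 U : wfun, weight la U &
  forall s x, size x = d -> Z s x = U (permw s x) - U x.
Proof.
have [[x0 x0l]|nox0] := pselect (exists x0 : seq nat, forall l :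
  nat, count_mem l x0 = la l); last first.
  exists 0 => [x|s x _]; first by rewrite eqxx.
  rewrite subrr; apply/eqP/negPn/negP => /Z_weight xl.
  by apply: nox0; exists x.
have sx0 := la_d x0l.
(* U is forced on the orbit of x0 once U x0 = 0; [cocycle_stab] makes the value independent of the
   chosen s. *)
pose U : wfun := fun x => if [pick s | permw s x0 == x] is Some s then Z s x0 else 0.
have UE s : U (permw s x0) = Z s x0.
  rewrite /U; case: pickP => [s' /eqP s'x|/(_ s)]; last by rewrite eqxx.
  have -> : s = (s' * (s'^-1 * s))%g by rewrite mulKVg.
  have fx0 : permw (s'^-1 * s) x0 = x0 by rewrite -permwM -s'x permwM mulVg permw1.
  by rewrite ZM // fx0 (cocycle_stab sx0 fx0) addr0.
have wU x : U x != 0 -> exists s : 'S_d, permw s x0 = x.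
  by rewrite /U; case: pickP => [s /eqP <- _|]; [exists s | rewrite eqxx].
exists U => [x /wU[s <-] l|s x sx].
  by rewrite -x0l; exact/seq.permP/perm_permw.
have [[s' <-]|nos] := pselect (exists s' : 'S_d, permw s' x0 = x).
  by rewrite permwM !UE ZM // addrK.
have Ux : U x = 0 by apply/eqP/negPn/negP => /wU.
have Usx : U (permw s x) = 0.
  apply/eqP/negPn/negP => /wU[s' eqs']; apply: nos; exists (s^-1 * s')%g.
  by rewrite -permwM eqs' permwM mulVg permw1.
rewrite Ux Usx subrr; apply/eqP/negPn/negP => /Z_weight xl; apply: nos.
have [|s' ->] := @perm_eq_permw d x0 x sx0; last by exists s'.
by apply/allP => l _ /=; rewrite xl x0l.
Qed.

End PermutationCocycle.

Section QuotientBijection.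

Local Open Scope quotient_scope.
Variables (F : fieldType) (V V' : vectType F) (W : {vspace V}) (W' : {vspace V'}).
Variable R : V -> V' -> Prop.
Hypothesis R_lin : forall a x x' y y', R x x' -> R y y' ->
  R (a *: x + y) (a *: x' + y').
Hypothesis R_total : forall x, exists x', R x x'.
Hypothesis R_total' : forall x', exists x, R x x'.
Hypothesis R_compat : forall x x', R x x' -> (x \in W) = (x' \in W').

(** A linear correspondence total on both sides: applied to differences, [R_compat] shows that the
    classes of related vectors determine each other. *)
Lemma quotv_bij : exists f : {linear quotv W -> quotv W'}, bijective f.
Proof.
have R_sub x x' y y' : R x x' -> R y y' -> (x - y \in W) = (x' - y' \in W').
  move=> xx' yy'; apply: R_compat.
  by rewrite -!scaleN1r ![x + _]addrC ![x' + _]addrC; exact: R_lin.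
pose up x := projT1 (cid (R_total x)).
have upR x : R x (up x) by exact: projT2 (cid (R_total x)).
pose dn x' := projT1 (cid (R_total' x')).
have dnR x' : R (dn x') x' by exact: projT2 (cid (R_total' x')).
pose f (q : quotv W) : quotv W' := \pi_(quotv W') (up (repr q)).
pose g (q : quotv W') : quotv W := \pi_(quotv W) (dn (repr q)).
have fE x x' : R x x' -> f (\pi_(quotv W) x) = \pi_(quotv W') x'.
  move=> xx'; apply/eqP; rewrite eq_quotv -(R_sub _ _ _ _ (upR _) xx').
  by rewrite -eq_quotv reprK.
have gE x x' : R x x' -> g (\pi_(quotv W') x') = \pi_(quotv W) x.
  move=> xx'; apply/eqP; rewrite eq_quotv (R_sub _ _ _ _ (dnR _) xx').
  by rewrite -eq_quotv reprK.
have f_lin : linear f.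
  move=> a q q'; rewrite -[q]reprK -[q']reprK.
  rewrite (fE _ _ (upR _)) (fE _ _ (upR _)).
  have <- : \pi_(quotv W) (a *: repr q + repr q') =
    a *: \pi_(quotv W) (repr q) + \pi_(quotv W) (repr q').
    by rewrite pi_quotvD pi_quotvZ.
  by rewrite (fE _ _ (R_lin a (upR _) (upR _))) pi_quotvD pi_quotvZ.
pose fl : {linear quotv W -> quotv W'} :=
  HB.pack f (GRing.isLinear.Build F (quotv W) (quotv W') _ f f_lin).
exists fl; exists g => q /=; rewrite -[q]reprK.
  by rewrite (fE _ _ (upR _)) (gE _ _ (upR _)).
by rewrite (gE _ _ (dnR _)) (fE _ _ (dnR _)).
Qed.

End QuotientBijection.

Section BarBasis.

Variable gT : finGroupType.

Definition bar1 (a : gT) : bar_basis gT 0 := [ffun=> a].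
Definition bar2 (a b : gT) : bar_basis gT 1 := [ffun j => if j == ord0 then a else b].
Definition bar3 (a b c : gT) : bar_basis gT 2 :=
  [ffun j => if j == ord0 then a else if j == ord_max then c else b].

Lemma bar2E (s : bar_basis gT 1) : s = bar2 (s ord0) (s ord_max).
Proof.
by apply/ffunP => j; rewrite ffunE; case: (eqVneq j ord0) => [->//|];
  case: j => -[|[|//]] // lt_j _;
   congr (s _); apply: val_inj.
Qed.

Variables (F : fieldType) (n : nat).

Lemma cobound0E (f : bar_fun F gT n 0) s :
  cobound f s = f (bar1 (s ord_max)) - f (bar1 (s ord0)).
Proof.
rewrite ffunE !big_ord_recl big_ord0 addr0 expr0 scale1r expr1 scaleN1r.
by congr (f _ - f _); apply/ffunP => j; rewrite !ffunE; congr (s _); apply: val_inj;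
  rewrite (ord1 j).
Qed.

Lemma cobound1E (f : bar_fun F gT n 1) s : cobound f s =
  f (bar2 (s (lift ord0 ord0)) (s ord_max)) - f (bar2 (s ord0) (s ord_max))
  + f (bar2 (s ord0) (s (lift ord0 ord0))).
Proof.
rewrite ffunE !big_ord_recl big_ord0 addr0 expr0 scale1r expr1 scaleN1r.
rewrite /= exprS mulN1r scaleNr expr1 scaleN1r opprK addrA.
by congr (f _ - f _ + f _); apply/ffunP => j; rewrite !ffunE;
  case: j => -[|[|//]] lt_j /=;
   congr (s _); apply: val_inj.
Qed.

Lemma bar2_act a b (g : gT) : bar_act (bar2 a b) g = bar2 (a * g)%g (b * g)%g.
Proof. by apply/ffunP => j; rewrite !ffunE; case: ifP. Qed.

Lemma cocycle_bar2 (rG : mx_representation F [set: gT] n) f : f \in cocycles rG 1 ->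
  (forall a b g, f (bar2 (a * g)%g (b * g)%g) = f (bar2 a b) *m rG g) /\
  (forall a b c, f (bar2 a c) = f (bar2 a b) + f (bar2 b c)).
Proof.
case/cocyclesP => fG f0; split=> [a b g|a b c]; first by rewrite -bar2_act fG.
have := congr1 (fun h : bar_fun F gT n 2 => h (bar3 a b c)) f0.
rewrite cobound1E !ffunE /= => /eqP; rewrite addrAC subr_eq0 => /eqP <-.
by rewrite addrC.
Qed.

End BarBasis.

(** * Cocycles with values in a Specht module and their primitives in M^mu *)

Section SpechtCohomology.

Variables (k : fieldType) (d : nat) (mu : seq nat).
Hypothesis mu_part : is_partition d mu.
Hypothesis two_neq0 : (2%:R : k) != 0.

Notation la := (fun l => nth 0%N mu l).
Notation N := #|{: tabloid d mu}|.
Notation S := (specht_mx k d mu).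
Notation rS := (specht k d mu).
Notation yg := (young_mx k mu).
Implicit Types (u v : 'rV[k]_N) (f : bar_fun k 'S_d (\rank S) 1) (s g : 'S_d).

Let reg2 : GRing.lreg (2%:R : k) := mulfI two_neq0.

Lemma vf_ext u v : (forall x, size x = d -> vf u x = vf v x) -> u = v.
Proof.
move=> uv; apply: vf_inj; apply/funext => x.
have [/uv //|nsx] := eqVneq (size x) d.
have out (w : 'rV[k]_N) : vf w x = 0.
  by apply: contra_neqP nsx => /eqP/vf_weight; exact: content_sized.
by rewrite !out.
Qed.

Definition primitive_of u f :=
  forall s : bar_basis 'S_d 1, val_submod (f s) =
    u *m yg (s ord_max) - u *m yg (s ord0).

Lemma yg1 u : u *m yg 1%g = u.
Proof. by rewrite -[yg 1%g]/(young_repr k d mu 1%g) repr_mx1 mulmx1. Qed.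

Lemma ygM u g h : u *m yg (g * h)%g = u *m yg g *m yg h.
Proof. by rewrite -[yg (g * h)%g]/(young_repr k d mu (g * h)%g) repr_mxM ?inE //
  mulmxA. Qed.

Lemma cocycle_primitive f : f \in cocycles rS 1 -> exists u, primitive_of u f.
Proof.
case/cocycle_bar2 => fM fC.
(* The inhomogeneous form of f, viewed in M^mu. *)
pose Z g : seq nat -> k^o := vf (val_submod (f (bar2 1%g g))).
have ZM b s x : size x = d -> Z (b * s)%g x = Z b (permw s x) + Z s x.
  move=> sx; rewrite /Z (fC 1%g s) -{2}[s]mul1g fM [f _ + _]addrC !raddfD /=.
  by rewrite (val_submodJ (specht_mxmodule k d mu)) ?inE // -vf_young.
have [U wU UZ] := cocycle_coboundary reg2 (@content_sized d mu mu_part)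
  (fun g => @vf_weight k d mu _) ZM.
have [u uU] := vf_surj mu_part wU; exists u => s.
apply: vf_ext => x sx;
  rewrite [s in LHS]bar2E raddfB /= -[RHS]/(vf _ x - vf _ x) !vf_young // uU.
have fE : f (bar2 (s ord0) (s ord_max)) =
  f (bar2 1%g (s ord_max)) - f (bar2 1%g (s ord0)).
  by rewrite (fC 1%g (s ord0)) [f _ + _]addrC addrK.
transitivity (Z (s ord_max) x - Z (s ord0) x); first by rewrite fE !raddfB.
by rewrite /Z !UZ // opprB addrA addrNK.
Qed.

Lemma primitive_cocycle u : (forall g, (u *m yg g - u <= S)%MS) ->
  exists2 f, f \in cocycles rS 1 & primitive_of u f.
Proof.
move=> uS.
have uS2 g h : (u *m yg g - u *m yg h <= S)%MS.
  have -> : u *m yg g - u *m yg h =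
    (u *m yg g - u) - (u *m yg h - u) by rewrite opprB addrA subrK.
  by rewrite addmx_sub ?eqmx_opp.
pose f : bar_fun k 'S_d (\rank S) 1 :=
  [ffun s : bar_basis 'S_d 1 => in_submod S (u *m yg (s ord_max) - u *m yg (s ord0))].
have fP : primitive_of u f by move=> s; rewrite ffunE in_submodK.
exists f => //; apply/cocyclesP; split=> [g s|].
  apply: (can_inj (@val_submodK _ _ _ _)).
  rewrite (val_submodJ (specht_mxmodule k d mu)) ?inE // !fP !ffunE /=.
  by rewrite mulmxBl -(ygM u (s ord_max) g) -(ygM u (s ord0) g).
apply/ffunP => s; rewrite cobound1E [RHS]ffunE.
apply: (can_inj (@val_submodK _ _ _ _)).
rewrite raddfD raddfB raddf0 /= !fP !ffunE /=.
have E (A B C : 'rV[k]_N) : A - B - (A - C) + (B - C) = 0.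
  by rewrite opprB [A - B + _]addrC !addrA !subrK subrr.
exact: E.
Qed.

(** Two primitives of f differ by an invariant vector, so f bounds in S exactly when u lies in S
    plus the invariants. *)
Lemma coboundaryP f u : primitive_of u f ->
  (f \in coboundaries rS 1) <->
  exists2 v, (v <= S)%MS & forall g, (u - v) *m yg g = u - v.
Proof.
move=> fu; split=> [/memv_imgP[f0 /cochainsP f0G fE]|[v vS uv]].
  exists (val_submod (f0 (bar1 1%g))); first exact: val_submodP.
  have f0E g : val_submod (f0 (bar1 g)) = val_submod (f0 (bar1 1%g)) *m yg g.
    rewrite -(val_submodJ (specht_mxmodule k d mu)) ?inE // -f0G;
      congr (val_submod (f0 _)).
    by apply/ffunP => j; rewrite !ffunE mul1g.
  move=> g; have := fu (bar2 1%g g);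
    rewrite fE lfunE /= cobound0E raddfB /= !ffunE /=.
  rewrite (f0E g) yg1 => E; rewrite mulmxBl -[u *m yg g](subrK u) -E.
  by rewrite addrAC [_ - _ - _]addrAC subrr add0r addrC.
pose f0 : bar_fun k 'S_d (\rank S) 0 :=
  [ffun s : bar_basis 'S_d 0 => in_submod S (v *m yg (s ord0))].
have vgS g : (v *m yg g <= S)%MS.
  by apply: submx_trans (submxMr _ vS) _; move/mxmoduleP: (specht_mxmodule k d mu);
    apply; rewrite inE.
apply/memv_imgP; exists f0; last first.
  apply/ffunP => s; rewrite lfunE /= cobound0E;
    apply: (can_inj (@val_submodK _ _ _ _)).
  rewrite fu raddfB /= !ffunE !in_submodK //.
  have uE g : u *m yg g = (u - v) + v *m yg g by rewrite -(uv g) mulmxBl subrK.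
  by rewrite !uE opprD addrACA subrr add0r.
apply/cochainsP => g s; apply: (can_inj (@val_submodK _ _ _ _)).
rewrite (val_submodJ (specht_mxmodule k d mu)) ?inE // !ffunE !in_submodK //.
exact: ygM.
Qed.

Lemma symw_invariant (w : seq nat -> k^o) (w_size : of_size d w) :
  (forall s x, size x = d -> w (permw s x) = w x) -> symw w.
Proof.
move=> ws x y xy; have [sx|nsx] := eqVneq (size x) d.
  by have [s ->] := perm_eq_permw sx xy; rewrite ws.
have out z : size z != d -> w z = 0 by move=> nz;
  apply/eqP/negPn/negP => /w_size/eqP; rewrite (negPf nz).
by rewrite !out // -(perm_size xy).
Qed.

Lemma vf_of_size u : of_size d (vf u).
Proof. by move=> x /vf_weight; exact: content_sized. Qed.

Lemma sub_specht_symw u :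
  (forall g, (u *m yg g - u <= S)%MS) <->
  (forall i m, (0 < m)%N -> symw (divpow i m (vf u))).
Proof.
have dE i m s x : size x = d ->
    divpow i m (vf (u *m yg s - u)) x =
      divpow i m (vf u) (permw s x) - divpow i m (vf u) x.
  move=> sx; rewrite -divpow_permw // !raddfB /= -[LHS]/(_ x - _ x); congr (_ - _).
  by apply: eq_recolor => y; rewrite mem_raises sx => /andP[/eqP sy _];
    exact: vf_young.
split=> [uS i m m0|symu g].
  apply: symw_invariant => [|s x sx]; first exact/of_size_divpow/vf_of_size.
  apply/eqP; rewrite -subr_eq0 -dE //.
  by move/(specht_kernel mu_part two_neq0): (uS s) => ->.
apply/(specht_kernel mu_part two_neq0) => i m m0; apply/funext => x.
have [sx|nsx] := eqVneq (size x) d; last first.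
  by apply: contra_neqP nsx => /eqP/(of_size_divpow (@vf_of_size _)).
by rewrite dE // (symu i m m0 _ x) ?subrr // perm_permw.
Qed.

(** The invariants of M^mu are the multiples of [total], and u - a [total] lies in S exactly when
    all divided powers kill it. *)
Lemma coboundary_total f u : primitive_of u f ->
  (f \in coboundaries rS 1) <->
  exists a, forall i m, (0 < m)%N -> divpow i m (vf u) = a *: divpow i m (total k la).
Proof.
move=> fu; rewrite (coboundaryP fu); split=> [[v vS uv]|[a ua]].
  have sym_uv : symw (vf (u - v)).
    apply: symw_invariant => [|s x sx]; first exact: vf_of_size.
    by rewrite -vf_young // uv.
  have [a aE] : exists a, vf (u - v) = a *: total k la.
    have [[x0 x0l]|nox] := pselect (exists x0 : seq nat, forall l :
      nat, count_mem l x0 = la l).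
      exists (vf (u - v) x0); apply/funext => x;
        rewrite -[RHS]/(_ * total k la x) /total.
      case: asboolP => xl.
        by rewrite mulr1; apply: sym_uv; apply/allP => l _ /=; rewrite xl x0l.
      by rewrite mulr0; apply/eqP/negPn/negP => /vf_weight.
    exists 0; rewrite scale0r; apply/funext => x;
      apply/eqP/negPn/negP => /vf_weight xl.
    by apply: nox; exists x.
  exists a => i m m0; rewrite -linearZ /= -aE raddfB raddfB /=.
  by move/(specht_kernel mu_part two_neq0): vS => ->; rewrite // subr0.
have [t tE] := vf_surj mu_part (@total_weight k la).
exists (u - a *: t).
  apply/(specht_kernel mu_part two_neq0) => i m m0.
  by rewrite raddfB /= raddfB /= linearZ /= linearZ /= tE ua // subrr.
move=> g; rewrite opprB addrC subrK; apply: vf_ext => x sx.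
rewrite vf_young // linearZ /= tE -[LHS]/(a * _) -[RHS]/(a * _).
by congr (a * _); apply: symw_total; exact: perm_permw.
Qed.

End SpechtCohomology.

Lemma add_first_part_raise0 mu q :
  (fun l => nth 0%N (add_first_part mu q) l) = raise0 (fun l => nth 0%N mu l) q.
Proof.
apply/funext => -[|l]; rewrite /raise0 /=; first by rewrite nth0 muln1.
by rewrite nth_behead muln0 addn0.
Qed.

Lemma is_partition_add_first d mu q : (0 < q)%N ->
  is_partition d mu -> is_partition (d + q) (add_first_part mu q).
Proof.
move=> q0 /and3P[mu_sorted mu0 /eqP <-]; apply/and3P; split.
- case: mu mu_sorted {mu0} => [|a [|b mu]] //= /andP[le_ba ->]; rewrite andbT.
  exact: leq_trans le_ba (leq_addr _ _).
- rewrite inE negb_or eq_sym -lt0n addn_gt0 q0 orbT /=.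
  by apply: contra mu0; exact: mem_behead.
- by case: mu {mu_sorted mu0} => [|a mu]; rewrite /= ?addn0 // addnAC.
Qed.

Theorem theorem7p1p8 (k : closedFieldType) (p : nat)
    (charkp : p \in [pchar k]) (p_ge3 : (3 <= p)%N)
    (d : nat) (d_ge1 : (1 <= d)%N)
    (la : seq nat) (la_part : is_partition d la)
    (r : nat) (r_gt0 : (0 < r)%N) (lt_d_pr : (d < p ^ r)%N) :
  exists f : {linear cohomology (specht k d la) 1 ->
      cohomology (specht k (d + p ^ r) (add_first_part la (p ^ r))) 1},
    bijective f.
Proof.
set q := (p ^ r)%N in lt_d_pr *; set la' := add_first_part la q.
have two_neq0 : (2%:R : k) != 0.
  by rewrite -(dvdn_pcharf charkp) gtnNdvd.
have q_gt0 : (0 < q)%N by exact: leq_ltn_trans lt_d_pr.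
have la'_part := is_partition_add_first q_gt0 la_part.
have laE : (fun l => nth 0%N la' l) = raise0 (fun l => nth 0%N la l) q.
  exact: add_first_part_raise0.
(* Cocycles are related when they have primitives whose divided powers correspond under [mulz]. *)
pose R (z : subvs_of (cocycles (specht k d la) 1))
       (z' : subvs_of (cocycles (specht k (d + q) la') 1)) : Prop :=
  exists u u', [/\ primitive_of u (vsval z), primitive_of u' (vsval z') &
    forall i m, (0 < m)%N -> divpow i m (vf u') = mulz q (divpow i m (vf u))].
have symu u (z : subvs_of (cocycles (specht k d la) 1)) :
    primitive_of u (vsval z) -> forall i m, (0 < m)%N -> symw (divpow i m (vf u)).
  move=> zu; apply/(sub_specht_symw la_part two_neq0) => g.
  have := zu (bar2 1%g g); rewrite !ffunE /= yg1 => <-; exact: val_submodP.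
have symu' u' (z' : subvs_of (cocycles (specht k (d + q) la') 1)) :
    primitive_of u' (vsval z') -> forall i m, (0 < m)%N -> symw (divpow i m (vf u')).
  move=> zu; apply/(sub_specht_symw la'_part two_neq0) => g.
  have := zu (bar2 1%g g); rewrite !ffunE /= yg1 => <-; exact: val_submodP.
apply: (@quotv_bij _ _ _ _ _ R).
- move=> a x x' y y' [u [u' [xu xu' uu']]] [v [v' [yv yv' vv']]].
  exists (a *: u + v), (a *: u' + v'); split=> [s|s|i m m0].
  + have -> : val_submod (vsval (a *: x + y) s) =
    a *: val_submod (vsval x s) + val_submod (vsval y s).
      by rewrite linearP !ffunE linearP.
    by rewrite xu yv !mulmxDl -!scalemxAl scalerBr opprD addrACA.
  + have -> : val_submod (vsval (a *: x' + y') s) =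
    a *: val_submod (vsval x' s) + val_submod (vsval y' s).
      by rewrite linearP !ffunE linearP.
    by rewrite xu' yv' !mulmxDl -!scalemxAl scalerBr opprD addrACA.
  by rewrite !linearP /= uu' // vv'.
- move=> z; have [u zu] := cocycle_primitive la_part two_neq0 (subvsP z).
  have w'_wt : weight (fun l => nth 0%N la' l) (mulz q (vf u)).
    by rewrite laE; apply: weight_mulz; exact: vf_weight.
  have [u' u'E] := vf_surj la'_part w'_wt.
  have uu' i m : divpow i m (vf u') =
    mulz q (divpow i m (vf u)) by rewrite u'E divpow_mulz.
  have [|f' f'Z f'u'] := @primitive_cocycle k (d + q) la' u'.
    apply/(sub_specht_symw la'_part two_neq0) => i m m0.
    by rewrite uu'; apply: symw_mulz; exact: symu zu i m m0.
  by exists (Subvs f'Z), u, u'; split.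
- move=> z'; have [u' zu'] := cocycle_primitive la'_part two_neq0 (subvsP z').
  have wu' : weight (raise0 (fun l => nth 0%N la l) q) (vf u') by rewrite -laE;
    exact: vf_weight.
  have [w w_wt ww'] := transfer_back charkp lt_d_pr (part_anti la_part) (@part_out la)
    wu' (@vf_of_size _ _ _ la'_part u') (symu' _ _ zu').
  have [u uE] := vf_surj la_part w_wt.
  have [|f fZ fu] := @primitive_cocycle k d la u.
    by apply/(sub_specht_symw la_part two_neq0) => i m m0; rewrite uE;
      have [] := ww' i m m0.
  by exists (Subvs fZ), u, u'; split=> // i m m0; rewrite uE; have [] := ww' i m m0.
(* Coboundaries correspond because [mulz] carries [total] to [total] and is injective on symmetric
   functions of degree d. *)
move=> z z' [u [u' [zu zu' uu']]].
rewrite -!memv_preim !lfunE /=; apply/idP/idP.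
  move=> /(coboundary_total la_part two_neq0 zu)[a ua].
  apply/(coboundary_total la'_part two_neq0 zu'); exists a => i m m0.
  rewrite uu' // ua // linearZ /= -divpow_mulz (mulz_total charkp lt_d_pr) ?laE //.
  exact: content_sized.
move=> /(coboundary_total la'_part two_neq0 zu')[a ua].
apply/(coboundary_total la_part two_neq0 zu); exists a => i m m0.
apply/eqP; rewrite -subr_eq0; apply/eqP; apply: (mulz_inj charkp lt_d_pr).
  rewrite -scaleN1r; apply: sym_of_sizeD; last apply/sym_of_sizeZ/sym_of_sizeZ.
    split; first exact: symu zu i m m0.
    exact/of_size_divpow/vf_of_size.
  apply: sym_of_size_divpow; split; first exact: symw_total.
  by move=> x /total_weight; exact: content_sized.
rewrite raddfB /= -uu' // ua // linearZ /= -divpow_mulz (mulz_total charkp lt_d_pr)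
  -?laE ?subrr //.
exact: content_sized.
Qed.
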